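(* Let $n,N\ge1$, $T>0$, $\mathbf c\in\mathbb R^n_+$, $\mathbf d\in\mathbb R^n_+$, $C\ge0$ with $d_{i+1}-d_i\le c_{i+1}$ for $i\in[n-1]$, let $\mathcal U=\{\mathbf u:\mathbf u^L\le\mathbf u\le\mathbf u^U\}$ with $0\le u^L_i<u^U_i<\infty$, and let $\widehat{\mathbf u}^1,\dots,\widehat{\mathbf u}^N\in\mathcal U$. For fixed $\bar{\mathbf s}\in\mathcal S$ and $\epsilon\ge0$, $\sup_{\mathbb Q\in\mathcal D_1(\widehat{\mathbb P}^N,\epsilon)}\mathbb E_{\mathbb Q}[f(\bar{\mathbf s},\mathbf u)]$ equals the optimal value of the linear program $$\max_{\mathbf p,\mathbf q,\mathbf r}\ \frac1N\sum_{j=1}^N\sum_{i=1}^n\sum_{\ell=i}^{n+1}\pi_{i\ell}\Big[(u^L_i-\widehat u^j_i)q_{i\ell j}+(u^U_i-\widehat u^j_i)r_{i\ell j}+\Big(\sum_{k=1}^ip_{k\ell j}\Big)(\widehat u^j_i-\bar s_i)\Big]$$ subject to $\frac1N\sum_{j=1}^N\sum_{i=1}^n\sum_{\ell=i}^{n+1}\big[(\widehat u^j_i-u^L_i)q_{i\ell j}+(u^U_i-\widehat u^j_i)r_{i\ell j}\big]\le\epsilon$; $\sum_{\ell=i}^{n+1}\sum_{k=1}^ip_{k\ell j}=1$ for all $i\in[n],j\in[N]$; $\sum_{k=1}^ip_{k\ell j}-q_{i\ell j}-r_{i\ell j}\ge0$ for all $i\in[n],\ell\in[i,n+1]_{\mathbb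 Z},j\in[N]$; and $p_{i\ell j},q_{i\ell j},r_{i\ell j}\ge0$ for all $i\in[n],\ell\in[i,n+1]_{\mathbb Z},j\in[N]$. Let $\{p^\star_{k\ell j},q^\star_{i\ell j},r^\star_{i\ell j}\}$ be an optimal solution and let $\mathcal T=\{\mathbf t\in\{0,1\}^{(n+1)(n+2)/2}:\sum_{k=1}^i\sum_{\ell=i}^{n+1}t_{k\ell}=1\ \forall i\in[n+1]\}$, where $\mathbf t$ is indexed by pairs $(k,\ell)$ with $1\le k\le\ell\le n+1$. Then for each $j\in[N]$ there exists a probability distribution $\mathbb P^j_{\mathbf t}$ on $\mathcal T$ with $\mathbb P^j_{\mathbf t}\{t_{k\ell}=1\}=p^\star_{k\ell j}$ for all $k\in[n]$, $\ell\in[k,n+1]_{\mathbb Z}$. Moreover, defining, with the convention $0/0=0$, $$u_{i\ell j}=\widehat u^j_i+\frac{q^\star_{i\ell j}(u^L_i-\widehat u^j_i)}{\sum_{k=1}^ip^\star_{k\ell j}}+\frac{r^\star_{i\ell j}(u^U_i-\widehat u^j_i)}{\sum_{k=1}^ip^\star_{k\ell j}},\qquad u^j_i(\boldsymbol\tau)=\sum_{\ell=i}^{n+1}\Big(\sum_{k=1}^i\tau_{k\ell}\Big)u_{i\ell j}$$ for $i\in[n]$, $j\in[N]$, $\boldsymbol\tau\in\mathcal T$, and $\mathbb Q^\star=\frac1N\sum_{j=1}^N\sum_{\boldsymbol\tau\in\mathcal T}\mathbb P^j_{\mathbf t}\{\mathbf t=\boldsymbol\tau\}\delta_{\mathbf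 u^j(\boldsymbol\tau)}$, we have $\mathbb Q^\star\in\mathcal D_1(\widehat{\mathbb P}^N,\epsilon)$ and $\mathbb E_{\mathbb Q^\star}[f(\bar{\mathbf s},\mathbf u)]=\sup_{\mathbb Q\in\mathcal D_1(\widehat{\mathbb P}^N,\epsilon)}\mathbb E_{\mathbb Q}[f(\bar{\mathbf s},\mathbf u)]$.
   Context: Notation: $[m]=\{1,\dots,m\}$, $[i,j]_{\mathbb Z}=\{i,\dots,j\}$; $\delta_{\mathbf x}$ is the Dirac measure at $\mathbf x$. $\mathcal S=\{\mathbf s\in\mathbb R^n:\mathbf s\ge0,\sum_is_i\le T\}$. $f(\mathbf s,\mathbf u)$ is the optimal value of $\min_{\mathbf w\in\mathbb R^{n+1},\mathbf v\in\mathbb R^n}\sum_{i=1}^n(c_iw_i+d_iv_i)+Cw_{n+1}$ s.t. $w_i-v_{i-1}=u_{i-1}+w_{i-1}-s_{i-1}$ ($i\in[2,n+1]_{\mathbb Z}$), $\mathbf w\ge0,w_1=0,\mathbf v\ge0$. $d_1(\mathbb Q_1,\mathbb Q_2)=\inf_\Pi\mathbb E_\Pi\|\mathbf u_1-\mathbf u_2\|_1$ over couplings $\Pi$; $\widehat{\mathbb P}^N=\frac1N\sum_j\delta_{\widehat{\mathbf u}^j}$; $\mathcal D_1(\widehat{\mathbb P}^N,\epsilon)$ is the set of probability distributions $\mathbb Q$ on $\mathcal U$ with $d_1(\mathbb Q,\widehat{\mathbb P}^N)\le\epsilon$. Constants: for $i\in[n]$, $\pi_{i\ell}=-d_\ell+\sum_{q=i+1}^\ell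 c_q$ for $\ell\in[i,n]_{\mathbb Z}$ and $\pi_{i,n+1}=C+\sum_{q=i+1}^nc_q$. *)

(* Defs.v *)
From HB Require Import structures.
From mathcomp Require Import all_boot all_order all_algebra.
From mathcomp Require Import all_classical all_reals all_analysis.
Unset Printing Implicit Defensive.
Import Order.TTheory GRing.Theory Num.Theory.
Import numFieldNormedType.Exports.
Local Open Scope classical_set_scope.
Local Open Scope ring_scope.

(* Conventions: all indices are 1-based natural numbers, as in the paper.
   Vectors of data (c, d, u^L, u^U, s) are functions nat -> R, of which only
   the entries 1..n matter.  Random vectors u live in n.-tuple R (equipped
   by MathComp-Analysis with the product = Borel sigma-algebra of R^n), and
   [crd u i] is the (1-based) i-th coordinate u_i. *)

Section Defs.
Variable R : realType.

Definition crd (n : nat) (u : n.-tuple R) (i : nat) : R := nth 0 u i.-1.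

Definition f_feasible (n : nat) (s : nat -> R) (u : n.-tuple R)
    (w v : nat -> R) : Prop :=
  w 1%N = 0 /\
  (forall i, (2 <= i <= n.+1)%N ->
     w i - v i.-1 = crd n u i.-1 + w i.-1 - s i.-1) /\
  (forall i, (1 <= i <= n.+1)%N -> 0 <= w i) /\
  (forall i, (1 <= i <= n)%N -> 0 <= v i).

Definition f_obj (n : nat) (c d : nat -> R) (C : R) (w v : nat -> R) : R :=
  \sum_(1 <= i < n.+1) (c i * w i + d i * v i) + C * w n.+1.

Definition fval (n : nat) (c d : nat -> R) (C : R) (s : nat -> R)
    (u : n.-tuple R) : \bar R :=
  ereal_inf [set x | exists w v : nat -> R,
    f_feasible n s u w v /\ x = (f_obj n c d C w v)%:E].

Definition in_S (n : nat) (T : R) (s : nat -> R) : Prop :=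
  (forall i, (1 <= i <= n)%N -> 0 <= s i) /\ \sum_(1 <= i < n.+1) s i <= T.

Definition Ubox (n : nat) (uL uU : nat -> R) : set (n.-tuple R) :=
  [set u | forall i, (1 <= i <= n)%N -> uL i <= crd n u i <= uU i].

Definition l1dist (n : nat) (x y : n.-tuple R) : R :=
  \sum_(1 <= i < n.+1) `|crd n x i - crd n y i|.

Definition is_coupling (n : nat)
    (Pi : probability (n.-tuple R * n.-tuple R)%type R)
    (Q1 Q2 : set (n.-tuple R) -> \bar R) : Prop :=
  forall A : set (n.-tuple R), measurable A ->
    Pi (A `*` setT) = Q1 A /\ Pi (setT `*` A) = Q2 A.

Definition d1 (n : nat) (Q1 Q2 : set (n.-tuple R) -> \bar R) : \bar R :=
  ereal_inf [set (\int[Pi]_x (l1dist n x.1 x.2)%:E)%E |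
    Pi in [set Pi | is_coupling n Pi Q1 Q2]].

Definition empirical (n N : nat) (uh : nat -> n.-tuple R)
    : set (n.-tuple R) -> \bar R :=
  fun A => ((N%:R)^-1%:E * \sum_(1 <= j < N.+1) \d_(uh j) A)%E.

Definition inD1 (n N : nat) (uL uU : nat -> R) (uh : nat -> n.-tuple R)
    (eps : R) (Q : probability (n.-tuple R) R) : Prop :=
  Q (Ubox n uL uU) = 1%E /\ (d1 n Q (empirical n N uh) <= eps%:E)%E.

Definition DRO_value (n N : nat) (c d : nat -> R) (C : R) (uL uU : nat -> R)
    (uh : nat -> n.-tuple R) (eps : R) (sbar : nat -> R) : \bar R :=
  ereal_sup [set (\int[Q]_u fval n c d C sbar u)%E |
    Q in [set Q | inD1 n N uL uU uh eps Q]].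

Definition piC (n : nat) (c d : nat -> R) (C : R) (i l : nat) : R :=
  if (l <= n)%N then - d l + \sum_(i.+1 <= q < l.+1) c q
  else C + \sum_(i.+1 <= q < n.+1) c q.

Definition Psum (p : nat -> nat -> nat -> R) (i l j : nat) : R :=
  \sum_(1 <= k < i.+1) p k l j.

Definition lp_obj (n N : nat) (c d : nat -> R) (C : R) (uL uU : nat -> R)
    (uh : nat -> n.-tuple R) (sbar : nat -> R)
    (p q r : nat -> nat -> nat -> R) : R :=
  N%:R^-1 * \sum_(1 <= j < N.+1) \sum_(1 <= i < n.+1) \sum_(i <= l < n.+2)
    piC n c d C i l *
      ((uL i - crd n (uh j) i) * q i l j + (uU i - crd n (uh j) i) * r i l j
       + Psum p i l j * (crd n (uh j) i - sbar i)).

Definition lp_feas (n N : nat) (uL uU : nat -> R) (uh : nat -> n.-tuple R)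
    (eps : R) (p q r : nat -> nat -> nat -> R) : Prop :=
  N%:R^-1 * \sum_(1 <= j < N.+1) \sum_(1 <= i < n.+1) \sum_(i <= l < n.+2)
    ((crd n (uh j) i - uL i) * q i l j + (uU i - crd n (uh j) i) * r i l j)
    <= eps /\
  (forall i j, (1 <= i <= n)%N -> (1 <= j <= N)%N ->
     \sum_(i <= l < n.+2) Psum p i l j = 1) /\
  (forall i l j, (1 <= i <= n)%N -> (i <= l <= n.+1)%N -> (1 <= j <= N)%N ->
     Psum p i l j - q i l j - r i l j >= 0) /\
  (forall i l j, (1 <= i <= n)%N -> (i <= l <= n.+1)%N -> (1 <= j <= N)%N ->
     0 <= p i l j /\ 0 <= q i l j /\ 0 <= r i l j).

Definition LP_value (n N : nat) (c d : nat -> R) (C : R) (uL uU : nat -> R)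
    (uh : nat -> n.-tuple R) (eps : R) (sbar : nat -> R) : \bar R :=
  ereal_sup [set x | exists p q r : nat -> nat -> nat -> R,
    lp_feas n N uL uU uh eps p q r /\
    x = (lp_obj n N c d C uL uU uh sbar p q r)%:E].

(* t is indexed by pairs (k,l), 1 <= k <= l <= n+1; we store it as a finite
   function on 'I_(n+1) * 'I_(n+1) (0-based), with entries k > l forced to 0. *)
Definition tvec (n : nat) := {ffun 'I_n.+1 * 'I_n.+1 -> bool}.

Definition tv (n : nat) (t : tvec n) (k l : nat) : bool :=
  t (inord k.-1, inord l.-1).

Definition inT (n : nat) (t : tvec n) : bool :=
  [forall k : 'I_n.+1, forall l : 'I_n.+1, (l < k)%N ==> ~~ t (k, l)] &&
  [forall i : 'I_n.+1,
     (\sum_(k < n.+1 | (k <= i)%N) \sum_(l < n.+1 | (i <= l)%N)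
        (t (k, l) : nat) == 1)%N].

Definition distT (n : nat) (P : tvec n -> R) : Prop :=
  (forall t, 0 <= P t) /\ (forall t, ~~ inT n t -> P t = 0) /\
  \sum_(t : tvec n) P t = 1.

Definition marginals_ok (n : nat) (P : tvec n -> R)
    (p : nat -> nat -> nat -> R) (j : nat) : Prop :=
  forall k l, (1 <= k <= n)%N -> (k <= l <= n.+1)%N ->
    \sum_(t : tvec n | tv n t k l) P t = p k l j.

Definition u_ilj (n : nat) (uL uU : nat -> R) (uh : nat -> n.-tuple R)
    (p q r : nat -> nat -> nat -> R) (i l j : nat) : R :=
  crd n (uh j) i + q i l j * (uL i - crd n (uh j) i) / Psum p i l j
               + r i l j * (uU i - crd n (uh j) i) / Psum p i l j.

Definition u_j_coord (n : nat) (uL uU : nat -> R) (uh : nat -> n.-tuple R)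
    (p q r : nat -> nat -> nat -> R) (j : nat) (tau : tvec n) (i : nat) : R :=
  \sum_(i <= l < n.+2)
     (\sum_(1 <= k < i.+1) ((tv n tau k l : nat)%:R : R)) * u_ilj n uL uU uh p q r i l j.

Definition u_j (n : nat) (uL uU : nat -> R) (uh : nat -> n.-tuple R)
    (p q r : nat -> nat -> nat -> R) (j : nat) (tau : tvec n) : n.-tuple R :=
  [tuple u_j_coord n uL uU uh p q r j tau i.+1 | i < n].

Definition Qstar (n N : nat) (uL uU : nat -> R) (uh : nat -> n.-tuple R)
    (p q r : nat -> nat -> nat -> R) (P : nat -> tvec n -> R)
    : set (n.-tuple R) -> \bar R :=
  fun A => ((N%:R)^-1%:E * \sum_(1 <= j < N.+1) \sum_(tau : tvec n | inT n tau)
              ((P j tau)%:E * \d_(u_j n uL uU uh p q r j tau) A))%E.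

End Defs.

(* Main.v *)
(* For fixed u the dual of the recourse problem is attained at a vertex encoded
   by a partition of [1, n+1] into intervals [k, l]: on such an interval the
   dual variable is y_i = pi_il.  Hence f(s, u) is the maximum, over t in T, of
   functions affine in u; the greedy solution w_{i+1} = max(0, w_i + u_i - s_i),
   with an interval ending at each i such that w_{i+1} = 0, gives attainment.

   LP <= DRO: the constraints on p say that p is a unit flow, so p is a convex
   combination of elements of T.  The resulting discrete distribution, moved
   along q and r, lies in the Wasserstein ball, and the vertex t gives a lower
   bound on f at the atom indexed by t.

   DRO <= LP: from a coupling of cost at most eps + dl one reads off p, q, r by
   taking expectations, given the sample uh j, of an optimal vertex t and of the
   relative displacements of u towards uL and uU.  This is feasible for
   eps + dl, and shrinking q and r makes it feasible for eps. *)
Require Import Defs.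
From HB Require Import structures.
From mathcomp Require Import all_boot all_order all_algebra.
From mathcomp Require Import all_classical all_reals all_analysis.
From mathcomp Require Import measurable_realfun zify ring lra.
Set Implicit Arguments.
Unset Strict Implicit.
Import Order.TTheory GRing.Theory Num.Theory.
Local Open Scope classical_set_scope.
Local Open Scope ring_scope.

(** * Elements of [T] as partitions of [1, n+1] into intervals *)

Section Blocks.
Variable n : nat.
Implicit Types (t : tvec n) (b : nat -> nat -> bool).

Definition tmk b : tvec n := [ffun x : 'I_n.+1 * 'I_n.+1 => b x.1.+1 x.2.+1].

Lemma tv_tmk b k l : (1 <= k <= n.+1)%N -> (1 <= l <= n.+1)%N ->
  tv n (tmk b) k l = b k l.
Proof.
by move=> hk hl; rewrite /tv ffunE /= !inordK ?prednK //; lia.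
Qed.

(** Moves from 0-based ordinals to sums over ranges of 1-based naturals, where index conditions fall
    to [lia]. *)
Lemma inTP t :
  reflect ((forall k l, (1 <= l)%N -> (l < k)%N -> (k <= n.+1)%N -> ~~ tv n t k l) /\
           (forall i, (1 <= i <= n.+1)%N ->
              (\sum_(1 <= k < i.+1) \sum_(i <= l < n.+2) tv n t k l = 1)%N))
    (inT n t).
Proof.
have cutE (i : 'I_n.+1) :
    (\sum_(k < n.+1 | (k <= i)%N) \sum_(l < n.+1 | (i <= l)%N) (t (k, l) : nat))%N
    = (\sum_(1 <= k < i.+2) \sum_(i.+1 <= l < n.+2) tv n t k l)%N.
  rewrite big_add1 /= (big_nat_widen _ _ n.+1) ?ltn_ord // big_mkord /=.
  apply: eq_big => // k _.
  rewrite big_add1 /= (big_nat_widenl _ 0) //= big_mkord /=.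
  apply: eq_bigr => l _; rewrite /tv /=.
  by congr (nat_of_bool (t (_, _))); apply/val_inj; rewrite /= inordK.
apply: (iffP andP) => [[/forallP h1 /forallP h2]|[h1 h2]]; split.
- move=> k l l1 lk kn.
  have /forallP /(_ (inord l.-1)) /implyP := h1 (inord k.-1).
  by apply; rewrite !inordK; lia.
- move=> i hi; have := h2 (inord i.-1).
  by rewrite cutE inordK ?prednK; try lia; move/eqP.
- apply/forallP => k; apply/forallP => l; apply/implyP => /= lk.
  have := h1 k.+1 l.+1 isT lk (ltn_ord k); rewrite /tv /=.
  by rewrite !inord_val.
- by apply/forallP => i; rewrite cutE h2 ?eqxx //=; exact: ltn_ord.
Qed.

(* An element of T is encoded by e, where e i is the right end of the interval
   that contains i. *)
Lemma inT_ends t : inT n t -> exists e : nat -> nat,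
  [/\ forall i, (1 <= i <= n.+1)%N -> (i <= e i <= n.+1)%N,
      forall i l, (1 <= i)%N -> (i <= l <= n.+1)%N ->
        (\sum_(1 <= k < i.+1) tv n t k l = (e i == l))%N &
      forall i, (1 <= i <= n)%N -> (i < e i)%N -> e i.+1 = e i].
Proof.
move=> /inTP [_ cut].
(* Counts the chosen intervals that start at or before i and end at l. For fixed i the cut condition
   makes these counts add up to 1 over l, so exactly one l has count 1; this l becomes [e i]. *)
pose a i l := (\sum_(1 <= k < i.+1) tv n t k l)%N.
have H i : exists l, (1 <= i <= n.+1)%N -> [/\ (i <= l <= n.+1)%N, a i l = 1%N &
    forall l', (i <= l' <= n.+1)%N -> l' != l -> a i l' = 0%N].
  have [hi|hi] := boolP (1 <= i <= n.+1)%N; last by exists 0%N.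
  have := cut i hi; rewrite exchange_big /= => /sum_nat_seq_eq1 [l [+ _ al z]].
  rewrite mem_index_iota => hl; exists l => _; split => // l' hl' ne.
  by apply: z; rewrite ?mem_index_iota.
have [e He] := choice H.
have aE i l : (1 <= i)%N -> (i <= l <= n.+1)%N -> a i l = (e i == l).
  move=> i1 hl; have [|h1 h2 h3] := He i; first lia.
  by have [<-//|ne] := eqVneq (e i) l; rewrite h3 // eq_sym.
exists e; split => //; first by move=> i /He [].
move=> i hi lt; have [|h1 h2 h3] := He i; first lia.
(* An interval that starts by i and ends at [e i] > i is counted again at i+1, so the count at (i+1,
   [e i]) cannot be 0. *)
have /(_ _)/wrap[] := aE i.+1 (e i) isT; first lia.
by rewrite /a big_nat_recr //= -/(a i (e i)) h2; case: eqP => //; lia.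
Qed.

(* Conversely, [1, n+1] is cut after each l with b l. *)
Lemma ends_inT (b : pred nat) : exists (t : tvec n) (e : nat -> nat),
  [/\ inT n t,
      forall i, (1 <= i <= n.+1)%N -> (i <= e i <= n.+1)%N,
      forall i l, (1 <= i)%N -> (i <= l <= n.+1)%N ->
        (\sum_(1 <= k < i.+1) tv n t k l = (e i == l))%N &
      forall i, (1 <= i <= n)%N -> if b i then e i = i else e i.+1 = e i].
Proof.
(* The list is i, ..., n. If it contains no cut, [find] returns its length n+1-i, and [e i] is
   n+1. *)
pose e i := (i + find b (iota i (n.+1 - i)))%N.
have eb i : (1 <= i <= n.+1)%N -> (i <= e i <= n.+1)%N.
  move=> hi; rewrite /e; have := find_size b (iota i (n.+1 - i)).
  by rewrite size_iota; lia.
have es i : (1 <= i <= n)%N -> if b i then e i = i else e i.+1 = e i.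
  move=> hi; rewrite /e (_ : n.+1 - i = (n.+1 - i.+1).+1)%N; last lia.
  by rewrite /=; case: (b i); lia.
(* The interval [k, l] is chosen when k opens an interval, that is k = 1 or a cut follows k-1, and l
   is its right end. *)
pose t := tmk (fun k l => [&& (k <= l)%N, e k == l & (k == 1%N) || b k.-1]).
have cov i l : (1 <= i)%N -> (i <= l <= n.+1)%N ->
    (\sum_(1 <= k < i.+1) tv n t k l = (e i == l))%N.
  case: i => // i _; elim: i l => [|i IH] l hl.
    by rewrite big_nat1 tv_tmk ?eqxx ?andbT; [case: ltnP => //; lia|lia|lia].
  rewrite big_nat_recr // IH /=; last lia.
  rewrite tv_tmk; [|lia|lia].
  have -> /= : (i.+2 <= l)%N by lia.
  have := es i.+1; case: (b i.+1) => [/(_ _) ->|/(_ _) ->]; lia.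
exists t, e; split => //; apply/inTP; split.
  by move=> k l l1 lk kn; rewrite tv_tmk; [|lia|lia]; rewrite leqNgt lk.
move=> i hi; rewrite exchange_big /=.
have /andP [h1 h2] := eb i hi.
rewrite (eq_big_nat _ _ (F2 := fun l => nat_of_bool (e i == l))); last first.
  by move=> l hl; apply: cov; lia.
rewrite (bigD1_seq (e i)) ?iota_uniq ?mem_index_iota //= ?eqxx; last lia.
by rewrite big1 // => l; rewrite eq_sym; case: eqP.
Qed.

End Blocks.

(** * The interval that covers a given point *)

Section Cover.
Variables (R : realType) (n : nat).

(** For t in [T] and i <= l, the indicator that the interval containing i ends at l; the counterpart
    of [Psum] for a single t. *)
Definition cov (t : tvec n) (i l : nat) : R :=
  \sum_(1 <= k < i.+1) ((tv n t k l : nat)%:R : R).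

Lemma covE t i l : cov t i l = (\sum_(1 <= k < i.+1) tv n t k l)%N%:R.
Proof. by rewrite /cov natr_sum. Qed.

Lemma cov_ge0 t i l : 0 <= cov t i l.
Proof. by rewrite covE ler0n. Qed.

Lemma sum_cov t i : inT n t -> (1 <= i <= n.+1)%N ->
  \sum_(i <= l < n.+2) cov t i l = 1.
Proof.
move=> /inTP [_ cut] hi; under eq_bigr do rewrite covE.
by rewrite -natr_sum exchange_big /= cut.
Qed.

Lemma sum_end (a : nat -> R) (e i : nat) : (i <= e <= n.+1)%N ->
  \sum_(i <= l < n.+2) (e == l)%:R * a l = a e.
Proof.
move=> he; rewrite (bigD1_seq e) ?iota_uniq ?mem_index_iota //= ?eqxx ?mul1r.
by rewrite big1 ?addr0 // => l; rewrite eq_sym => /negbTE ->; rewrite mul0r.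
Qed.

Lemma sum_cov_end t (e : nat -> nat) i (a : nat -> R) :
  (forall i, (1 <= i <= n.+1)%N -> (i <= e i <= n.+1)%N) ->
  (forall i l, (1 <= i)%N -> (i <= l <= n.+1)%N ->
     (\sum_(1 <= k < i.+1) tv n t k l = (e i == l))%N) ->
  (1 <= i <= n)%N -> \sum_(i <= l < n.+2) cov t i l * a l = a (e i).
Proof.
move=> e1 e2 hi; rewrite -[RHS](@sum_end a (e i) i); last by apply: e1; lia.
by apply: eq_big_nat => l hl; rewrite covE e2 //; lia.
Qed.

End Cover.

(** * Linear programming duality for the recourse problem *)

Section Duality.
Variables (R : realType) (n : nat) (c d : nat -> R) (C : R) (s : nat -> R).
Hypothesis c_ge0 : forall i, (1 <= i <= n)%N -> 0 <= c i.
Hypothesis d_ge0 : forall i, (1 <= i <= n)%N -> 0 <= d i.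
Hypothesis C_ge0 : 0 <= C.
Hypothesis dc : forall i, (1 <= i <= n.-1)%N -> d i.+1 - d i <= c i.+1.
Local Notation pi := (piC R n c d C).

(* The dual objective at the vertex of the dual polyhedron encoded by t. *)
Definition vertex_value (t : tvec n) (y : nat -> R) : R :=
  \sum_(1 <= i < n.+1) \sum_(i <= l < n.+2) cov R t i l * (pi i l * (y i - s i)).

Lemma piC_rec i l : (i < l)%N -> (i < n)%N -> pi i l = c i.+1 + pi i.+1 l.
Proof.
by move=> il ni; rewrite /piC; case: ifP => _; rewrite big_ltn; ring || lia.
Qed.

Lemma piC_diag i : (i <= n)%N -> pi i i = - d i.
Proof. by move=> h; rewrite /piC h big_geq // addr0. Qed.

(** Dual feasibility with respect to v_i for y_i = pi_il. Descending induction on i: pi_il = c_{i+1}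
    + pi_{i+1,l} >= c_{i+1} - d_{i+1} >= -d_i, by the condition on the increments of d. *)
Lemma piC_ge i l : (1 <= i <= n)%N -> (i <= l <= n.+1)%N -> - d i <= pi i l.
Proof.
have [m] := ubnP (n - i); elim: m i => // m IH i im hi hl.
have [<-|il] := eqVneq i l; first by rewrite piC_diag ?lexx //; lia.
have [ni|ni] := eqVneq i n.
  have -> : l = n.+1 by lia.
  rewrite /piC ltnn big_geq ?addr0; last lia.
  by move: (d_ge0 hi) C_ge0 => hd C0; lra.
rewrite piC_rec; [|lia|lia].
have IHi : - d i.+1 <= pi i.+1 l by apply: IH; lia.
have dci : d i.+1 - d i <= c i.+1 by apply: dc; lia.
by lra.
Qed.

(** Multiply the i-th balance equation by y_i = [pi i (e i)] and sum by parts. The coefficients of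
    v_i, w_i and w_{n+1} are controlled by the dual constraints -y_i <= d_i, y_{i-1} - y_i <= c_i
    and y_n <= C. *)
Lemma weak_duality t (u : n.-tuple R) w v : inT n t ->
  f_feasible R n s u w v -> vertex_value t (crd R n u) <= f_obj R n c d C w v.
Proof.
move=> /inT_ends [e [e1 e0 e2]] [w1 [wE [w0 v0]]].
rewrite /vertex_value (eq_big_nat _ _ (F2 := fun i =>
   pi i (e i) * (w i.+1 - v i - w i))); last first.
  move=> i hi; rewrite (sum_cov_end (fun l => pi i l * (crd R n u i - s i)) e1 e0) //.
  have E : w i.+1 - v i = crd R n u i + w i - s i by apply: (wE i.+1); lia.
  by congr (_ * _); lra.
(* The last term is the boundary term of the summation by parts. At m = 0 its index has no meaning,
   but it is multiplied by w_1 = 0. *)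
have ind m : (m <= n)%N ->
    \sum_(1 <= i < m.+1) pi i (e i) * (w i.+1 - v i - w i) <=
    \sum_(1 <= i < m.+1) (c i * w i + d i * v i) + pi m (e m) * w m.+1.
  elim: m => [|m IH] mn; first by rewrite !big_geq // w1 mulr0 addr0.
  rewrite big_nat_recr //= [X in _ <= X + _]big_nat_recr //=.
  have {}IH := IH (ltnW mn).
  have vp : 0 <= (pi m.+1 (e m.+1) + d m.+1) * v m.+1.
    apply: mulr_ge0; last by apply: v0; lia.
    by rewrite -lerBlDr sub0r piC_ge //; try apply: e1; lia.
  suff : 0 <= (pi m.+1 (e m.+1) + c m.+1 - pi m (e m)) * w m.+1 by nra.
  case: m mn {IH vp} => [|m] mn; first by rewrite w1 mulr0.
  apply: mulr_ge0; last by apply: w0; lia.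
  rewrite subr_ge0.
  (* Inside an interval the constraint y_{m+1} - y_{m+2} <= c_{m+2} is an equality. At a right end
     y_{m+1} = -d_{m+1}, and [piC_ge] at m+2 with the increment condition gives it. *)
  have [lt|ge] := ltnP m.+1 (e m.+1).
    rewrite (e2 m.+1); [|lia|lia].
    by rewrite [leLHS]piC_rec 1?addrC //; lia.
  have -> : e m.+1 = m.+1 by have := e1 m.+1; lia.
  rewrite piC_diag; last lia.
  have dcm : d m.+2 - d m.+1 <= c m.+2 by apply: dc; lia.
  have pm : - d m.+2 <= pi m.+2 (e m.+2) by apply: piC_ge; [|apply: e1]; lia.
  by lra.
apply: le_trans (ind n (leqnn n)) _; rewrite /f_obj lerD2l.
have [->|n0] := posnP n; first by rewrite w1 !mulr0.
apply: ler_wpM2r; first by apply: w0; lia.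
(* The constraint y_n <= C: y_n is -d_n if an interval ends at n, and C otherwise. *)
have [en|ne] := eqVneq (e n) n.
  rewrite en piC_diag //; have dn : 0 <= d n by apply: d_ge0; lia.
  by move: C_ge0 => ?; lra.
have -> : e n = n.+1 by have := e1 n; lia.
by rewrite /piC ltnn big_geq // addr0.
Qed.

(** Complementary slackness between the greedy w, v and the t that is cut where w vanishes: v_i > 0
    forces w_{i+1} = 0, so an interval ends at i and y_i = -d_i; w_i > 0 with 2 <= i <= n puts i-1
    and i into one interval, so y_{i-1} - y_i = c_i. The inequalities of weak duality become
    equalities. *)
Lemma strong_duality (u : n.-tuple R) : exists2 t, inT n t &
  exists w v, [/\ f_feasible R n s u w v, 0 <= f_obj R n c d C w v &
    f_obj R n c d C w v = vertex_value t (crd R n u)].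
Proof.
pose w := fix w i := if i is m.+1 then
  (if m is 0%N then 0 else Num.max 0 (w m + crd R n u m - s m)) else 0.
pose v i := w i.+1 - (w i + crd R n u i - s i).
have w1 : w 1%N = 0 by [].
have w0 i : 0 <= w i by case: i => [|[|i]] //=; rewrite le_max lexx.
have wS i : (1 <= i)%N -> w i.+1 = Num.max 0 (w i + crd R n u i - s i) by case: i.
have v0 i : (1 <= i)%N -> 0 <= v i.
  by move=> hi; rewrite subr_ge0 wS // le_max lexx orbT.
have wv i : (1 <= i)%N -> w i.+1 != 0 -> v i = 0.
  by move=> hi; rewrite /v wS //; case: leP; rewrite ?eqxx // subrr.
have [t [e [tT e1 e0 e2]]] := ends_inT n (fun l => w l.+1 == 0).
exists t => //; exists w, v; split.
- split => //; split; last by split => i hi //; apply: v0; lia.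
  by case=> [|[|i]] hi; [lia|lia|rewrite /v; ring].
- rewrite /f_obj addr_ge0 ?mulr_ge0 // big_seq sumr_ge0 // => i.
  rewrite mem_index_iota => hi.
  by rewrite addr_ge0 ?mulr_ge0 // ?c_ge0 ?d_ge0 ?v0 //; lia.
rewrite /vertex_value (eq_big_nat _ _ (F2 := fun i =>
   pi i (e i) * (w i.+1 - v i - w i))); last first.
  move=> i hi; rewrite (sum_cov_end (fun l => pi i l * (crd R n u i - s i)) e1 e0) //.
  by congr (_ * _); rewrite /v; ring.
clearbody v w.
suff ind m : (m <= n)%N ->
    \sum_(1 <= i < m.+1) pi i (e i) * (w i.+1 - v i - w i) =
    \sum_(1 <= i < m.+1) (c i * w i + d i * v i) + pi m (e m) * w m.+1.
  rewrite ind // /f_obj; congr (_ + _).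
  have [->|n0] := posnP n; first by rewrite w1 !mulr0.
  have := e2 n; case: eqP => [->|wn en]; first by rewrite !mulr0.
  have <- : e n.+1 = e n by apply: en; lia.
  have -> : e n.+1 = n.+1 by have := e1 n.+1; lia.
  by rewrite /piC ltnn big_geq // addr0.
elim: m => [|m IH] mn; first by rewrite !big_geq // w1 mulr0 addr0.
rewrite big_nat_recr //= [X in _ = X + _]big_nat_recr //= (IH (ltnW mn)).
have vp : (pi m.+1 (e m.+1) + d m.+1) * v m.+1 = 0.
  have [wm|wm] := eqVneq (w m.+2) 0; last by rewrite wv ?mulr0.
  have := e2 m.+1; rewrite wm eqxx => ->; last lia.
  by rewrite piC_diag // addNr mul0r.
suff wp : (pi m.+1 (e m.+1) + c m.+1 - pi m (e m)) * w m.+1 = 0.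
  apply/subr0_eq; transitivity
    (- ((pi m.+1 (e m.+1) + c m.+1 - pi m (e m)) * w m.+1)
     - (pi m.+1 (e m.+1) + d m.+1) * v m.+1); first by ring.
  by rewrite wp vp subr0 oppr0.
case: m mn {IH vp} => [|m] mn; first by rewrite w1 mulr0.
have := e2 m.+1; case: eqP => [->|wm em]; first by rewrite mulr0.
rewrite em; last lia.
have me : (m.+1 < e m.+1)%N by have := e1 m.+2; rewrite em; lia.
by rewrite (piC_rec me) // [X in X - _]addrC subrr mul0r.
Qed.

(** Weak duality for every t and the primal-dual pair of strong duality pin down the infimum.
    Nonnegativity is recorded so that integrals of this function can be treated as integrals of
    nonnegative functions. *)
Lemma fvalE (u : n.-tuple R) : exists2 t, inT n t &
  [/\ fval R n c d C s u = (vertex_value t (crd R n u))%:E,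
     0 <= vertex_value t (crd R n u) &
     forall t', inT n t' ->
       vertex_value t' (crd R n u) <= vertex_value t (crd R n u)].
Proof.
have [t tT [w [v [wvf obj0 objE]]]] := strong_duality u.
exists t => //; rewrite -objE; split => //; last first.
  by move=> t' t'T; exact: weak_duality.
apply/eqP; rewrite eq_le; apply/andP; split.
  by apply: ereal_inf_lbound; exists w, v.
apply/ereal_infP => _ [w' [v' [wvf' ->]]].
by rewrite lee_fin objE weak_duality.
Qed.

End Duality.

(** * Decomposition of a unit flow into elements of [T] *)

Section FlowDecomposition.
Variables (R : realType) (n : nat).

(** An interval [k, n+1] stands for one whose end is still undecided; here it is replaced by [k, i]
    and [i+1, n+1]. *)
Definition close_at (i : nat) (t : tvec n) : tvec n :=
  tmk n (fun k l => if l == i then (k <= i)%N && tv n t k n.+1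
                    else if l == n.+1 then k == i.+1 else tv n t k l).

(** Decisions have been made only before i: for t in [T], the last interval is undecided and
    contains [i, n+1]. *)
Definition open_from (i : nat) (t : tvec n) : Prop :=
  (forall k l, (1 <= k <= l)%N -> (i <= l <= n)%N -> ~~ tv n t k l) /\
  (forall k, (i < k <= n.+1)%N -> ~~ tv n t k n.+1).

(** Since no interval ends in [i, n], the cut at i can only be met by an interval that ends at
    n+1. *)
Lemma open_start (i : nat) (t : tvec n) : (1 <= i <= n.+1)%N -> inT n t ->
  open_from i t -> exists2 k0, (1 <= k0 <= i)%N &
    forall k, (1 <= k <= i)%N -> tv n t k n.+1 = (k == k0).
Proof.
move=> hi /inTP [_ cut] [ho1 ho2]; have := cut i hi => cut1.
have : (\sum_(1 <= k < i.+1) (tv n t k n.+1 : nat) = 1)%N.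
  apply: etrans cut1; apply: eq_big_nat => k hk.
  rewrite [RHS]big_nat_recr /=; last lia.
  rewrite big_nat_cond big1 // => l hl.
  by rewrite (negbTE (ho1 k l _ _)); lia.
move=> /sum_nat_seq_eq1 [k0 [+ _ t0 z]]; rewrite mem_index_iota => hk0.
exists k0 => // k hk; have [->|ne] := eqVneq k k0; first by case: tv t0.
have : tv n t k n.+1 = 0%N :> nat by apply: z => //; rewrite mem_index_iota; lia.
by case: tv.
Qed.

Lemma sum_two_cells (F : nat -> nat) m i : (m <= i <= n)%N ->
  (\sum_(m <= l < n.+2) F l =
   \sum_(m <= l < i) F l + \sum_(i.+1 <= l < n.+1) F l + (F i + F n.+1))%N.
Proof.
move=> hi; rewrite big_nat_recr /=; last lia.
rewrite (big_cat_nat _ (n := i)) /=; [|lia|lia].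
by rewrite [in X in (_ + X + _)%N]big_ltn; lia.
Qed.

Lemma tv_close_at i t k l : (1 <= k <= n.+1)%N -> (1 <= l <= n.+1)%N ->
  tv n (close_at i t) k l = if l == i then (k <= i)%N && tv n t k n.+1
                    else if l == n.+1 then k == i.+1 else tv n t k l.
Proof. exact: tv_tmk. Qed.

Lemma close_at_inT i t : (1 <= i <= n)%N -> inT n t -> open_from i t ->
  inT n (close_at i t).
Proof.
move=> hi tT ot; have /inTP [h1 cut] := tT.
have [ho1 ho2] := ot.
apply/inTP; split=> [k l l1 lk kn|m hm].
  rewrite tv_close_at; [|lia|lia]; case: eqP => [li|_].
    by have -> : (k <= i)%N = false by lia.
  by case: eqP => [|_]; [lia|exact: h1].
(* A cut at m <= i sees the undecided interval move from column n+1 to column i; a cut at m > i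
   meets only the new interval [i+1, n+1]. *)
have [mi|im] := leqP m i.
  apply: etrans (cut m hm); apply: eq_big_nat => k hk.
  rewrite !(@sum_two_cells _ m i); [|lia|lia].
  congr addn; last first.
    rewrite !tv_close_at ?eqxx; try lia.
    rewrite (negbTE (ho1 k i _ _)); [|lia|lia].
    by case: tv; case: eqP => //=; lia.
  by congr addn; apply: eq_big_nat => l hl; rewrite tv_close_at; try lia;
    (case: eqP => [|_]; first lia); (case: eqP => [|_] //; lia).
rewrite (eq_big_nat _ _ (F2 := fun k => nat_of_bool (k == i.+1))); last first.
  move=> k hk; rewrite big_nat_recr /=; last lia.
  rewrite big_nat_cond big1 ?add0n; last first.
    move=> l hl; rewrite tv_close_at; [|lia|lia].
    case: eqP => [|_]; first lia.
    case: eqP => [|_]; first lia.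
    by rewrite (negbTE (ho1 k l _ _)); lia.
  rewrite tv_close_at; [|lia|lia].
  by rewrite eqxx; case: eqP => //; lia.
rewrite (bigD1_seq i.+1) ?iota_uniq ?mem_index_iota //= ?eqxx.
by rewrite big1 // => l /negbTE ->.
Qed.

Lemma close_at_open i t : (1 <= i <= n)%N -> open_from i t ->
  open_from i.+1 (close_at i t).
Proof.
move=> hi [ho1 ho2]; split=> [k l hk hl|k hk]; rewrite tv_close_at; try lia.
  case: eqP => [|_]; first lia.
  by case: eqP => [|_]; [lia|apply: ho1; lia].
by case: eqP => [|_]; [lia|rewrite eqxx; lia].
Qed.

(* The interval process is Markov: at point i, the interval that started at k
   and is still open is closed with probability p k i / \sum_(l >= i) p k l. *)
Lemma flow_decomposition (p : nat -> nat -> R) : (1 <= n)%N ->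
  (forall k l, (1 <= k <= n)%N -> (k <= l <= n.+1)%N -> 0 <= p k l) ->
  (forall i, (1 <= i <= n)%N ->
     \sum_(i <= l < n.+2) \sum_(1 <= k < i.+1) p k l = 1) ->
  exists P : tvec n -> R, distT R n P /\
    forall k l, (1 <= k <= n)%N -> (k <= l <= n.+1)%N ->
      \sum_(t : tvec n | tv n t k l) P t = p k l.
Proof.
move=> n_gt0 p_ge0 cutp.
(* Mass of the intervals that start at k and reach i. *)
pose out k i := \sum_(i <= l < n.+2) p k l.
pose mass (P : tvec n -> R) k l := \sum_t P t * (tv n t k l)%:R.
have massE P k l : \sum_(t : tvec n | tv n t k l) P t = mass P k l.
  rewrite big_mkcond; apply: eq_bigr => t _.
  by case: tv; rewrite (mulr1, mulr0).
(* After step i, the intervals that end at or before i have their final law, and column n+1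
   temporarily holds every interval still open. *)
suff inv i : (i <= n)%N -> exists P : tvec n -> R, [/\ distT R n P,
    forall t, P t != 0 -> open_from i.+1 t,
    forall k l, (1 <= k <= l)%N -> (l < i.+1)%N -> mass P k l = p k l &
    forall k, (1 <= k <= i.+1)%N -> (k <= n)%N -> mass P k n.+1 = out k i.+1].
  have [P [dP _ Pl Pn]] := inv n (leqnn n).
  exists P; split => // k l hk hl; rewrite massE.
  have [->|ne] := eqVneq l n.+1; first by rewrite Pn ?/out ?big_nat1 //; lia.
  by apply: Pl; lia.
elim: i => [|i IH] hi.
  pose t0 := tmk n (fun k l => (k == 1%N) && (l == n.+1)).
  have t0E k l : (1 <= k <= n.+1)%N -> (1 <= l <= n.+1)%N ->
    tv n t0 k l = (k == 1%N) && (l == n.+1) by exact: tv_tmk.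
  exists (fun t => (t == t0)%:R); split.
  - split; first by move=> t; exact: ler0n.
    split; last by rewrite (bigD1 t0) //= eqxx big1 ?addr0 // => t /negbTE ->.
    move=> t; case: eqP => [->|//] /negP[]; apply/inTP; split.
      by move=> k l l1 lk kn; rewrite t0E; lia.
    move=> m hm; rewrite big_ltn; last lia.
    rewrite big_nat_recr /=; last lia.
    rewrite t0E ?eqxx; [|lia|lia].
    rewrite big_nat_cond big1; last by move=> l hl; rewrite t0E; lia.
    rewrite big_nat_cond big1 // => k hk; rewrite big_nat_cond big1 // => l hl.
    by rewrite t0E; lia.
  - move=> t; case: (eqVneq t t0) => [->|_] /=; rewrite ?eqxx // => _; split.
      by move=> k l hk hl; rewrite t0E; lia.
    by move=> k hk; rewrite t0E; lia.
  - by move=> k l hk hl; exfalso; lia.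
  - move=> k hk _; have -> : k = 1%N by lia.
    rewrite /mass (bigD1 t0) //= eqxx t0E ?eqxx //; last by lia.
    rewrite big1 ?addr0 ?mulr1; last by move=> t /negbTE ->; rewrite mul0r.
    by rewrite -(cutp 1%N) //; apply: eq_bigr => l _; rewrite big_nat1.
have [P [[P0 [PT P1]] Popen Pl Pn]] := IH (ltnW hi).
set j := i.+1 in Popen Pl Pn.
have hj : (1 <= j <= n)%N by lia.
have out_ge0 k : (1 <= k <= j)%N -> 0 <= out k j.
  move=> hk; rewrite /out big_nat_cond sumr_ge0 // => l hl.
  by apply: p_ge0; lia.
have outS k : out k j = p k j + out k j.+1 by rewrite /out big_ltn //; lia.
have outS_ge0 k : (1 <= k <= j)%N -> 0 <= out k j.+1.
  move=> hk; rewrite /out big_nat_cond sumr_ge0 // => l hl.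
  by apply: p_ge0; lia.
(* If [out k j] = 0, the quotient is 0 by convention and [p k j] = 0 as well, so [thM] holds in all
   cases. *)
pose th k := p k j / out k j.
have thM k : (1 <= k <= j)%N -> th k * out k j = p k j.
  move=> hk; have [out0|out0] := eqVneq (out k j) 0; last by rewrite divfK.
  have p0 : 0 <= p k j by apply: p_ge0; lia.
  by move: (outS k) (outS_ge0 k hk); rewrite out0 mulr0; lra.
have th01 k : (1 <= k <= j)%N -> 0 <= th k <= 1.
  move=> hk; have p0 : 0 <= p k j by apply: p_ge0; lia.
  rewrite divr_ge0 ?out_ge0 //=.
  have [out0|out0] := eqVneq (out k j) 0; first by rewrite /th out0 invr0 mulr0.
  have op : 0 < out k j by rewrite lt_def out0 out_ge0.
  by rewrite ler_pdivrMr // mul1r outS lerDl outS_ge0.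
pose tht t := \sum_(1 <= k < j.+1) th k * (tv n t k n.+1)%:R.
have start t : P t != 0 -> exists2 k0, (1 <= k0 <= j)%N & tht t = th k0 /\
    forall k, (1 <= k <= j)%N -> tv n t k n.+1 = (k == k0).
  move=> Pt; have tT : inT n t by apply: contraNT Pt => /PT ->.
  have hj' : (1 <= j <= n.+1)%N by lia.
  have [k0 hk0 k0E] := open_start hj' tT (Popen t Pt).
  exists k0 => //; split => //; rewrite /tht (bigD1_seq k0) ?iota_uniq
    ?mem_index_iota //= k0E // eqxx mulr1 big_nat_cond big1 ?addr0 // => k hk.
  rewrite k0E; last lia.
  by case: eqP hk; rewrite ?mulr0 //; lia.
(* One step of the chain: t is closed at j with probability [tht t], which is [th] at the start of
   its only open interval, and kept otherwise. *)
pose P' t' := \sum_t P t * ((1 - tht t) * (t' == t)%:R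
                            + tht t * (t' == close_at j t)%:R).
have P'E (phi : tvec n -> R) : \sum_t P' t * phi t =
    \sum_t P t * ((1 - tht t) * phi t + tht t * phi (close_at j t)).
  under eq_bigr do rewrite mulr_suml.
  rewrite exchange_big /=; apply: eq_bigr => t _.
  under eq_bigr do rewrite -mulrA mulrDl -!mulrA.
  rewrite -mulr_sumr big_split /= -!mulr_sumr.
  have pick t0 : \sum_t' (t' == t0)%:R * phi t' = phi t0.
    rewrite (bigD1 t0) //= eqxx mul1r big1 ?addr0 // => t' /negbTE ->.
    by rewrite mul0r.
  by rewrite !pick.
have massP' k l : mass P' k l = \sum_t P t *
  ((1 - tht t) * (tv n t k l)%:R + tht t * (tv n (close_at j t) k l)%:R).
  exact: P'E.
have P'0 t' : P' t' != 0 -> exists2 t, P t != 0 & t' = t \/ t' = close_at j t.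
  move=> h; apply: contrapT => /forall2NP no; case/negP: h; apply/eqP.
  apply: big1 => t _; have [->|Pt] := eqVneq (P t) 0; first by rewrite mul0r.
  have [/(_ Pt)//|] := no t.
  move=> /not_orP [/eqP/negbTE -> /eqP/negbTE ->].
  by rewrite !mulr0 addr0 mulr0.
exists P'; split.
- split.
    move=> t'; apply: sumr_ge0 => t _.
    have [->|Pt] := eqVneq (P t) 0; first by rewrite mul0r.
    have [k0 hk0 [-> _]] := start t Pt.
    have /andP [t0 t1] := th01 k0 hk0.
    by rewrite mulr_ge0 // addr_ge0 // mulr_ge0 ?ler0n // subr_ge0.
  split.
    move=> t' nT; apply: contraNeq nT => /P'0 [t Pt].
    have tT : inT n t by apply: contraNT Pt => /PT ->.
    by case=> -> //; apply: close_at_inT => //; exact: Popen.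
  have := P'E (fun=> 1); under eq_bigr do rewrite mulr1; move=> ->.
  by apply: etrans P1; apply: eq_bigr => t _; ring.
- move=> t' /P'0 [t Pt]; have ot := Popen t Pt.
  case=> ->; last exact: close_at_open.
  by case: ot => ho1 ho2; split => [k l hk hl|k hk]; [apply: ho1|apply: ho2]; lia.
- move=> k l hk; rewrite ltnS leq_eqVlt => /orP[/eqP lj|lj]; rewrite massP'.
    rewrite lj -thM; last lia.
    rewrite -(Pn k); [|lia|lia].
    rewrite /mass mulr_sumr; apply: eq_bigr => t _.
    have [->|Pt] := eqVneq (P t) 0; first by rewrite !mul0r mulr0.
    have [k0 hk0 [-> k0E]] := start t Pt.
    rewrite tv_close_at ?eqxx; [|lia|lia].
    have [ho1 _] := Popen t Pt.
    rewrite (negbTE (ho1 k j _ _)); [|lia|lia].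
    rewrite k0E; last lia.
    have -> /= : (k <= j)%N by lia.
    by case: eqP => [->|_]; rewrite ?mulr0 ?addr0 ?mulr0 // add0r !mulr1 mulrC.
  rewrite -(Pl k l hk lj); apply: eq_bigr => t _.
  rewrite tv_close_at; [|lia|lia].
  case: eqP => [|_]; first lia.
  case: eqP => [|_]; first lia.
  by congr (_ * _); ring.
- move=> k hk kn; rewrite massP'.
  have [kj|jk] := leqP k j.
    have -> : out k j.+1 = (1 - th k) * out k j.
      by rewrite mulrBl mul1r thM ?outS; [ring|lia].
    rewrite -(Pn k); [|lia|lia].
    rewrite /mass mulr_sumr; apply: eq_bigr => t _.
    have [->|Pt] := eqVneq (P t) 0; first by rewrite !mul0r mulr0.
    have [k0 hk0 [-> k0E]] := start t Pt.
    rewrite tv_close_at; [|lia|lia].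
    case: eqP => [|_]; first lia.
    rewrite eqxx k0E; last lia.
    have -> : (k == j.+1) = false by lia.
    by case: eqP => [->|_]; rewrite ?mulr0 ?addr0 ?mulr0 // !mulr1 mulrC.
  have kE : k = j.+1 by lia.
  (* An interval starts at j+1 exactly when one ends at j; subtracting the cuts at j and j+1 shows
     that this mass is what [p] sends out of j+1. *)
  transitivity (\sum_(1 <= k < j.+1) p k j).
    rewrite (eq_big_nat _ _ (F2 := fun k => th k * mass P k n.+1)); last first.
      by move=> k' hk'; rewrite Pn; [rewrite thM //; lia|lia|lia].
    under [RHS]eq_bigr do rewrite /mass mulr_sumr.
    rewrite exchange_big /=; apply: eq_bigr => t _.
    have [->|Pt] := eqVneq (P t) 0.
      by rewrite mul0r big1 // => k' _; rewrite mul0r mulr0.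
    have [_ ho2] := Popen t Pt.
    rewrite tv_close_at ?(negbTE (ho2 k _)); try lia.
    rewrite kE mulr0 add0r; case: eqP => [|_]; first lia.
    rewrite eqxx eqxx mulr1 /tht mulr_sumr; apply: eq_bigr => k' _.
    by rewrite mulrCA.
  have : \sum_(k <= l < n.+2) \sum_(1 <= k' < k.+1) p k' l = 1.
    by apply: cutp; lia.
  have := cutp j hj; rewrite big_ltn; last lia.
  move=> E; rewrite -{}E {2}kE => E; move: E.
  rewrite (eq_bigr (fun l => \sum_(1 <= k0 < j.+1) p k0 l + p k l)); last first.
    by move=> l _; rewrite kE big_nat_recr.
  by rewrite big_split /= -/(out k k) addrC kE => /addIr.
Qed.

End FlowDecomposition.

(** * Finite mixtures of Dirac measures *)

Section UnitMass.
Context {d} {T : measurableType d} {R : realType}.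
Variables (mu : {measure set T -> \bar R}) (mu1 : mu setT = 1%E).

(** An alias of [mu] that depends on the proof of unit mass, so that a probability structure can be
    attached to it. *)
Definition unit_mass_probability of (mu setT = 1%E) : set T -> \bar R := mu.
Local Notation nu := (unit_mass_probability mu1).

HB.instance Definition _ := Measure.copy nu mu.
HB.instance Definition _ := Measure_isProbability.Build _ _ _ nu mu1.
End UnitMass.

(** A finite sum of scaled Dirac measures along an enumeration of [I], so that integrals of
    nonnegative functions are computed term by term. *)
Lemma finite_mixture {d} {T : measurableType d} {R : realType} (I : finType)
    (a : I -> R) (x : I -> T) : (forall i, 0 <= a i) -> \sum_i a i = 1 ->
  exists Q : probability T R,
    (forall A, Q A = (\sum_i (a i)%:E * \d_(x i) A)%E) /\
    (forall h : T -> \bar R, measurable_fun setT h -> (forall y, 0 <= h y)%E ->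
       (\int[Q]_y h y = \sum_i (a i)%:E * h (x i))%E).
Proof.
move=> a_ge0 a1.
have [i0 _] : exists i : I, true.
  apply: contrapT => /forallNP no; have /eqP := a1.
  by rewrite big1 ?(eq_sym 0) ?oner_eq0 // => i _; have := no i.
pose e k := nth i0 (enum I) k.
have sumE (F : I -> \bar R) : (\sum_(k < #|I|) F (e k) = \sum_i F i)%E.
  by rewrite -[RHS]big_enum [RHS](big_nth i0) big_mkord -cardE.
pose m (k : nat) : {measure set T -> \bar R} :=
  mscale (NngNum (a_ge0 (e k))) (dirac (x (e k))).
pose Q0 : {measure set T -> \bar R} := msum m #|I|.
have Q0E A : Q0 A = (\sum_i (a i)%:E * \d_(x i) A)%E.
  by rewrite -(sumE (fun i => (a i)%:E * \d_(x i) A)%E).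
have Q01 : Q0 setT = 1%E.
  rewrite Q0E (eq_bigr (fun i => (a i)%:E)); last first.
    by move=> i _; rewrite diracT mule1.
  by rewrite sumEFin a1.
pose Q : probability T R := unit_mass_probability Q01.
exists Q; split; first exact: Q0E.
move=> h mh h0; rewrite -(sumE (fun i => (a i)%:E * h (x i))%E).
rewrite [LHS](_ : _ = \int[msum m #|I|]_y h y)%E //.
rewrite ge0_integral_measure_sum //; apply: eq_bigr => k _.
by rewrite ge0_integral_mscale // integral_dirac // diracT mul1e.
Qed.

(** * Bounded measurable functions *)

Section BoundedMeasurable.
Context {d} {T : measurableType d} {R : realType}.

(** These functions form an algebra and are integrable under any probability, so expectations become
    real numbers to which linearity applies freely. *)
Definition bmeas (h : T -> R) : Prop :=
  measurable_fun setT h /\ exists K, forall x, `|h x| <= K.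

Lemma bmeas_cst r : bmeas (fun=> r).
Proof. by split => //; exists `|r|. Qed.

Lemma bmeasD g h : bmeas g -> bmeas h -> bmeas (fun x => g x + h x).
Proof.
move=> [mg [K gK]] [mh [L hL]]; split; first exact: measurable_funD.
by exists (K + L) => x; apply: le_trans (ler_normD _ _) _; exact: lerD.
Qed.

Lemma bmeasM g h : bmeas g -> bmeas h -> bmeas (fun x => g x * h x).
Proof.
move=> [mg [K gK]] [mh [L hL]]; split; first exact: measurable_funM.
by exists (K * L) => x; rewrite normrM ler_pM.
Qed.

Lemma bmeasZ r h : bmeas h -> bmeas (fun x => r * h x).
Proof. by move=> bh; apply: bmeasM => //; exact: bmeas_cst. Qed.

Lemma bmeasB g h : bmeas g -> bmeas h -> bmeas (fun x => g x - h x).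
Proof.
move=> bg bh; apply: bmeasD => //.
have -> : (fun x => - h x) = (fun x => -1 * h x) by apply/funext => x; rewrite mulN1r.
exact: bmeasZ.
Qed.

Lemma bmeas_sum (I : eqType) (r : seq I) (F : I -> T -> R) :
  (forall i, i \in r -> bmeas (F i)) -> bmeas (fun x => \sum_(i <- r) F i x).
Proof.
elim: r => [|i r IH] bF.
  by under eq_fun do rewrite big_nil; exact: bmeas_cst.
under eq_fun do rewrite big_cons; apply: bmeasD.
  by apply: bF; rewrite mem_head.
by apply: IH => j jr; apply: bF; rewrite inE jr orbT.
Qed.

Lemma bmeas_prod (I : eqType) (r : seq I) (F : I -> T -> R) :
  (forall i, i \in r -> bmeas (F i)) -> bmeas (fun x => \prod_(i <- r) F i x).
Proof.
elim: r => [|i r IH] bF.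
  by under eq_fun do rewrite big_nil; exact: bmeas_cst.
under eq_fun do rewrite big_cons; apply: bmeasM.
  by apply: bF; rewrite mem_head.
by apply: IH => j jr; apply: bF; rewrite inE jr orbT.
Qed.

Lemma bmeas_max g h : bmeas g -> bmeas h -> bmeas (fun x => Num.max (g x) (h x)).
Proof.
move=> [mg [K gK]] [mh [L hL]]; split; first exact: measurable_maxr.
exists (Num.max K L) => x; rewrite le_max.
by case: (leP (g x) (h x)) => _; rewrite ?gK ?hL ?orbT.
Qed.

Lemma bmeas_bool (b : T -> bool) : measurable_fun setT b ->
  bmeas (fun x => (b x)%:R).
Proof.
move=> mb; split; last by exists 1 => x; case: (b x); rewrite ?normr1 ?normr0.
have -> : (fun x => (b x)%:R : R) = (fun x => if b x then 1 else 0).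
  by apply/funext => x; case: (b x).
exact: measurable_fun_ifT.
Qed.

(** Expand over the finitely many outcomes v of the tests: [phi v] times a product of indicators.
    This serves to select an optimal vertex measurably. *)
Lemma bmeas_tests (I : finType) (b : I -> T -> bool) (phi : {ffun I -> bool} -> R) :
  (forall i, measurable_fun setT (b i)) ->
  bmeas (fun x => phi [ffun i => b i x]).
Proof.
move=> mb.
have -> : (fun x => phi [ffun i => b i x]) =
    (fun x => \sum_(v : {ffun I -> bool}) phi v * \prod_i (b i x == v i)%:R).
  apply/funext => x; rewrite (bigD1 [ffun i => b i x]) //=.
  rewrite big1 ?mulr1; last by move=> i _; rewrite ffunE eqxx.
  rewrite big1 ?addr0 // => v ne.
  have [i ni] : exists i, b i x != v i.
    apply/existsP; apply: contraNT ne; rewrite negb_exists => /forallP h.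
    by apply/eqP/ffunP => i; rewrite ffunE; have := h i; rewrite negbK => /eqP.
  by rewrite (bigD1 i) //= (negbTE ni) mul0r mulr0.
apply: bmeas_sum => v _; apply: bmeasZ; apply: bmeas_prod => i _.
apply: (bmeas_bool (b := fun x => b i x == v i)); case: (v i).
  by rewrite (_ : (fun x => b i x == true) = b i) //; apply/funext => x; rewrite eqb_id.
rewrite (_ : (fun x => b i x == false) = (fun x => ~~ b i x)).
  exact: measurable_neg.
by apply/funext => x; rewrite eqbF_neg.
Qed.

End BoundedMeasurable.

(** * Expectations of bounded measurable functions *)

Section BoundedIntegral.
Context {d} {T : measurableType d} {R : realType} (P : probability T R).
Local Notation E h := (Rintegral P setT h).

Lemma bmeas_integrable h : bmeas h -> P.-integrable setT (EFin \o h).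
Proof.
move=> [mh [K hK]]; apply: measurable_bounded_integrable => //.
  by rewrite [X in (X < _)%E]probability_setT ltry.
exists K; split; first exact: num_real.
by move=> M KM x _ /=; exact: le_trans (hK x) (ltW KM).
Qed.

Lemma bexpD g h : bmeas g -> bmeas h -> E (fun x => g x + h x) = E g + E h.
Proof. by move=> bg bh; apply: RintegralD => //; exact: bmeas_integrable. Qed.

Lemma bexpZ r h : bmeas h -> E (fun x => r * h x) = r * E h.
Proof. by move=> bh; apply: RintegralZl => //; exact: bmeas_integrable. Qed.

Lemma bexp_cst r : E (fun=> r) = r.
Proof.
by rewrite Rintegral_cst // [X in fine X]probability_setT mulr1.
Qed.

Lemma bexp_sum (I : eqType) (r : seq I) (F : I -> T -> R) :
  (forall i, i \in r -> bmeas (F i)) ->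
  E (fun x => \sum_(i <- r) F i x) = \sum_(i <- r) E (F i).
Proof.
elim: r => [|i r IH] bF.
  by under eq_fun do rewrite big_nil; rewrite big_nil bexp_cst.
under eq_fun do rewrite big_cons; rewrite big_cons bexpD ?IH //.
- by move=> j jr; apply: bF; rewrite inE jr orbT.
- by apply: bF; rewrite mem_head.
- by apply: bmeas_sum => j jr; apply: bF; rewrite inE jr orbT.
Qed.

Lemma bexp_le g h : bmeas g -> bmeas h -> (forall x, g x <= h x) -> E g <= E h.
Proof. by move=> bg bh gh; apply: le_Rintegral => //; exact: bmeas_integrable. Qed.

Lemma bexp_ge0 h : (forall x, 0 <= h x) -> 0 <= E h.
Proof. by move=> h0; exact: Rintegral_ge0. Qed.

Lemma bexpE h : bmeas h -> (E h)%:E = (\int[P]_x (h x)%:E)%E.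
Proof.
move=> bh; rewrite /Rintegral fineK //.
exact: (integrable_fin_num _ (bmeas_integrable bh)).
Qed.

End BoundedIntegral.

(** * Measurability of coordinates, boxes and the distance *)

Section Measurability.
Context {R : realType} {n : nat}.

Lemma crd_tnth (u : n.-tuple R) (i : 'I_n) : crd R n u i.+1 = tnth u i.
Proof. by rewrite /crd /= (tnth_nth 0). Qed.

Lemma measurable_crd i : measurable_fun setT (fun u : n.-tuple R => crd R n u i).
Proof.
have [ni|ni] := ltnP i.-1 n; last first.
  rewrite (_ : (fun _ => _) = fun=> 0) //; apply/funext => u.
  by rewrite /crd nth_default // size_tuple.
rewrite (_ : (fun _ => _) = (fun u : n.-tuple R => tnth u (Ordinal ni))).
  exact: measurable_tnth.
by apply/funext => u; rewrite (tnth_nth 0).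
Qed.

Lemma eq_crd (u v : n.-tuple R) :
  (forall i, (1 <= i <= n)%N -> crd R n u i = crd R n v i) -> u = v.
Proof.
move=> uv; apply: eq_from_tnth => i; rewrite -!crd_tnth uv //.
exact: ltn_ord.
Qed.

Lemma measurable_box (uL uU : nat -> R) : measurable (Ubox R n uL uU).
Proof.
have -> : Ubox R n uL uU = \bigcap_(i in [set i | (1 <= i <= n)%N])
    ((fun u : n.-tuple R => crd R n u i) @^-1` `[uL i, uU i]).
  by apply/seteqP; split => u h i hi; have := h i hi; rewrite /= in_itv.
apply: bigcap_measurableType => i _.
by rewrite -[X in measurable X]setTI; exact: measurable_crd.
Qed.

Lemma measurable_tuple1 (a : n.-tuple R) : measurable [set a].
Proof.
have -> : [set a] = Ubox R n (crd R n a) (crd R n a).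
  apply/seteqP; split => [u -> i _|u h]; first by rewrite lexx.
  by apply: eq_crd => i hi; apply/eqP; rewrite eq_le andbC; exact: h.
exact: measurable_box.
Qed.

Lemma l1dist_ge0 (x y : n.-tuple R) : 0 <= l1dist R n x y.
Proof. by apply: sumr_ge0. Qed.

Lemma measurable_l1dist :
  measurable_fun setT (fun x : n.-tuple R * n.-tuple R => l1dist R n x.1 x.2).
Proof.
apply: measurable_sum => i; apply: measurableT_comp => //.
by apply: measurable_funB; apply: (measurableT_comp (measurable_crd i)).
Qed.

End Measurability.

(** * Measurable choice of an optimal vertex *)

Section ValueFunction.
Variables (R : realType) (n : nat) (c d : nat -> R) (C : R) (s : nat -> R).
Hypothesis c_ge0 : forall i, (1 <= i <= n)%N -> 0 <= c i.
Hypothesis d_ge0 : forall i, (1 <= i <= n)%N -> 0 <= d i.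
Hypothesis C_ge0 : 0 <= C.
Hypothesis dc : forall i, (1 <= i <= n.-1)%N -> d i.+1 - d i <= c i.+1.
Local Notation vv t u := (@vertex_value R n c d C s t (crd R n u)).
Local Notation fval := (fval R n c d C s).

Definition fr (u : n.-tuple R) : R := fine (fval u).

Lemma fvalEfr u : fval u = (fr u)%:E.
Proof. by rewrite /fr; have [t _ [-> _ _]] := fvalE s c_ge0 d_ge0 C_ge0 dc u. Qed.

Lemma fr_ge0 u : 0 <= fr u.
Proof. by rewrite /fr; have [t _ [-> + _]] := fvalE s c_ge0 d_ge0 C_ge0 dc u. Qed.

Lemma vertex_le_fr t u : inT n t -> vv t u <= fr u.
Proof.
move=> tT; rewrite /fr; have [t' _ [-> _ +]] := fvalE s c_ge0 d_ge0 C_ge0 dc u.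
exact.
Qed.

(** The maximiser is read off the table of pairwise comparisons, hence depends on u through finitely
    many measurable tests. The default is never reached on a table that comes from some u. *)
Definition best_vertex (v : {ffun tvec n * tvec n -> bool}) : tvec n :=
  odflt [ffun=> false] [pick t | inT n t && [forall t', inT n t' ==> v (t', t)]].

Definition vertex_table (u : n.-tuple R) : {ffun tvec n * tvec n -> bool} :=
  [ffun tt => vv tt.1 u <= vv tt.2 u].

Lemma best_vertexP u : let t := best_vertex (vertex_table u) in
  inT n t /\ fr u = vv t u.
Proof.
rewrite /best_vertex; case: pickP => /= [t /andP [tT /forallP tmax]|none].
  split => //; apply/eqP; rewrite eq_le vertex_le_fr // andbT /fr.
  have [t' t'T [-> _ _]] := fvalE s c_ge0 d_ge0 C_ge0 dc u.
  by have := tmax t'; rewrite t'T ffunE.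
have [t' t'T [_ _ h]] := fvalE s c_ge0 d_ge0 C_ge0 dc u.
have /negP[] := none t'; rewrite t'T; apply/forallP => t; apply/implyP => tT.
by rewrite ffunE h.
Qed.

Section Along.
Context {dd} {T : measurableType dd} (Y : T -> n.-tuple R).
Hypothesis mY : forall i, measurable_fun setT (fun x => crd R n (Y x) i).

Lemma measurable_vertex t : measurable_fun setT (fun x => vv t (Y x)).
Proof.
apply: measurable_sum => i; apply: measurable_sum => l.
by do 2 apply: measurable_funM => //; apply: measurable_funB.
Qed.

Lemma bmeas_best (phi : tvec n -> R) :
  bmeas (fun x => phi (best_vertex (vertex_table (Y x)))).
Proof.
have mtest (tt : tvec n * tvec n) :
    measurable_fun setT (fun x => vv tt.1 (Y x) <= vv tt.2 (Y x)).
  by apply: measurable_fun_ler; exact: measurable_vertex.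
exact: (bmeas_tests (phi \o best_vertex) mtest).
Qed.

(** Splitting by the chosen vertex gives a finite sum of indicators times functions affine in
    [Y x]. *)
Lemma measurable_fr : measurable_fun setT (fun x => fr (Y x)).
Proof.
have -> : (fun x => fr (Y x)) = (fun x => \sum_t
    (best_vertex (vertex_table (Y x)) == t)%:R * vv t (Y x)).
  apply/funext => x; have [_ ->] := best_vertexP (Y x).
  set b := best_vertex _; rewrite (bigD1 b) //= eqxx mul1r.
  by rewrite big1 ?addr0 // => t /negbTE; rewrite eq_sym => ->; rewrite mul0r.
apply: measurable_sum => t; apply: measurable_funM; last exact: measurable_vertex.
by case: (bmeas_best (fun b => (b == t)%:R)).
Qed.

End Along.
End ValueFunction.

(** * The distribution built from a feasible point of the linear program *)

Section WorstCase.
Variables (R : realType) (n N : nat) (c d : nat -> R) (C : R).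
Variables (uL uU : nat -> R) (uh : nat -> n.-tuple R) (sbar : nat -> R) (eps : R).
Hypothesis N_gt0 : (1 <= N)%N.
Hypothesis c_ge0 : forall i, (1 <= i <= n)%N -> 0 <= c i.
Hypothesis d_ge0 : forall i, (1 <= i <= n)%N -> 0 <= d i.
Hypothesis C_ge0 : 0 <= C.
Hypothesis dc : forall i, (1 <= i <= n.-1)%N -> d i.+1 - d i <= c i.+1.
Hypothesis uh_box : forall j, (1 <= j <= N)%N -> Ubox R n uL uU (uh j).
Variables (p q r : nat -> nat -> nat -> R) (P : nat -> tvec n -> R).
Hypothesis pqr : lp_feas R n N uL uU uh eps p q r.
Hypothesis Pp : forall j, (1 <= j <= N)%N ->
  distT R n (P j) /\ marginals_ok R n (P j) p j.
Local Notation ui := (u_ilj R n uL uU uh p q r).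
Local Notation uj := (u_j R n uL uU uh p q r).
Local Notation Ps := (Psum R p).
Local Notation crd := (crd R n).

Lemma crd_u_j j t i : (1 <= i <= n)%N ->
  crd (uj j t) i = \sum_(i <= l < n.+2) cov R t i l * ui i l j.
Proof.
case: i => // i hi; rewrite (@crd_tnth _ _ _ (Ordinal hi)) tnth_mktuple.
by [].
Qed.

Lemma sum_P_cov j i l : (1 <= j <= N)%N -> (1 <= i <= n)%N ->
  (i <= l <= n.+1)%N -> \sum_t P j t * cov R t i l = Ps i l j.
Proof.
move=> /Pp [_ mP] hi hl; rewrite /cov /Psum.
under eq_bigr do rewrite mulr_sumr.
rewrite exchange_big /=; apply: eq_big_nat => k hk.
rewrite -mP; [|lia|lia]; rewrite [RHS]big_mkcond; apply: eq_bigr => t _.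
by case: tv; rewrite (mulr1, mulr0).
Qed.

(** Averaging over t turns [cov] into [Psum], which converts sums over atoms into expressions of the
    linear program. *)
Lemma sum_P_cov_mul j (a : nat -> nat -> R) : (1 <= j <= N)%N ->
  \sum_t P j t * \sum_(1 <= i < n.+1) \sum_(i <= l < n.+2) cov R t i l * a i l =
  \sum_(1 <= i < n.+1) \sum_(i <= l < n.+2) Ps i l j * a i l.
Proof.
move=> hj; under eq_bigr do rewrite mulr_sumr.
rewrite exchange_big /=; apply: eq_big_nat => i hi.
under eq_bigr do rewrite mulr_sumr.
rewrite exchange_big /=; apply: eq_big_nat => l hl.
rewrite -sum_P_cov //.
by rewrite mulr_suml; apply: eq_bigr => t _; rewrite mulrA.
Qed.

Lemma lp_pos i l j : (1 <= j <= N)%N -> (1 <= i <= n)%N ->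
  (i <= l <= n.+1)%N -> [/\ 0 <= q i l j, 0 <= r i l j & q i l j + r i l j <= Ps i l j].
Proof.
move=> hj hi hl; have [_ [_ [h3 h4]]] := pqr.
have [_ [q0 r0]] := h4 _ _ _ hi hl hj; split => //.
by have := h3 _ _ _ hi hl hj; lra.
Qed.

Lemma uh_bounds i j : (1 <= j <= N)%N -> (1 <= i <= n)%N ->
  uL i <= crd (uh j) i <= uU i.
Proof. by move=> hj hi; exact: uh_box. Qed.

(* When Psum vanishes so do q and r, which makes the convention 0/0 = 0 harmless. *)
Lemma Psum_u_ilj i l j : (1 <= j <= N)%N -> (1 <= i <= n)%N ->
  (i <= l <= n.+1)%N -> Ps i l j * (ui i l j - crd (uh j) i) =
  q i l j * (uL i - crd (uh j) i) + r i l j * (uU i - crd (uh j) i).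
Proof.
move=> hj hi hl; have [q0 r0 qr] := lp_pos hj hi hl.
rewrite /u_ilj; have [Ps0|Ps0] := eqVneq (Ps i l j) 0; last by field.
rewrite Ps0 in qr *; have -> : q i l j = 0 by lra.
have -> : r i l j = 0 by lra.
by rewrite !mul0r addr0.
Qed.

(** If [Psum] is positive, this point is a convex combination of uL, the sample and uU with weights
    q / Psum, r / Psum and the remainder; the bounds are checked after multiplication by [Psum].
    Otherwise it is the sample itself. *)
Lemma u_ilj_box i l j : (1 <= j <= N)%N -> (1 <= i <= n)%N ->
  (i <= l <= n.+1)%N -> uL i <= ui i l j <= uU i.
Proof.
move=> hj hi hl; have [q0 r0 qr] := lp_pos hj hi hl.
have /andP [hL hU] := uh_bounds hj hi.
have [Ps0|Ps0] := eqVneq (Ps i l j) 0.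
  by rewrite /u_ilj Ps0 invr0 !mulr0 !addr0 hL hU.
have Ps1 : 0 < Ps i l j by rewrite lt_def Ps0; lra.
have uE := Psum_u_ilj hj hi hl.
have h1 : 0 <= (Ps i l j - q i l j) * (crd (uh j) i - uL i) by rewrite mulr_ge0; lra.
have h2 : 0 <= (Ps i l j - r i l j) * (uU i - crd (uh j) i) by rewrite mulr_ge0; lra.
have h3 : 0 <= q i l j * (crd (uh j) i - uL i) by rewrite mulr_ge0 //; lra.
have h4 : 0 <= r i l j * (uU i - crd (uh j) i) by rewrite mulr_ge0 //; lra.
by apply/andP; split; rewrite -(ler_pM2l Ps1); lra.
Qed.

Lemma u_j_box j t : (1 <= j <= N)%N -> inT n t -> Ubox R n uL uU (uj j t).
Proof.
move=> hj tT i hi; rewrite crd_u_j //; have [e [e1 e0 _]] := inT_ends tT.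
rewrite (sum_cov_end (fun l => ui i l j) e1 e0) //.
by apply: u_ilj_box => //; apply: e1; lia.
Qed.

(** At each i a single l has weight 1, so the absolute value may be taken inside the sum over l. *)
Lemma l1dist_u_j j t : inT n t -> l1dist R n (uj j t) (uh j) =
  \sum_(1 <= i < n.+1) \sum_(i <= l < n.+2) cov R t i l * `|ui i l j - crd (uh j) i|.
Proof.
move=> tT; apply: eq_big_nat => i hi; have [e [e1 e0 _]] := inT_ends tT.
rewrite crd_u_j // !(sum_cov_end _ e1 e0) //.
Qed.

Lemma vertex_value_u_j j t : inT n t ->
  vertex_value c d C sbar t (crd (uj j t)) =
  \sum_(1 <= i < n.+1) \sum_(i <= l < n.+2)
    cov R t i l * (piC R n c d C i l * (ui i l j - sbar i)).
Proof.
move=> tT; apply: eq_big_nat => i hi; have [e [e1 e0 _]] := inT_ends tT.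
rewrite crd_u_j // (sum_cov_end _ e1 e0) // !(sum_cov_end _ e1 e0) //.
Qed.

Lemma sum_pair_nat (F : nat -> tvec n -> R) :
  \sum_(i : 'I_N * tvec n) F i.1.+1 i.2 = \sum_(1 <= j < N.+1) \sum_t F j t.
Proof.
by rewrite big_add1 /= big_mkord (pair_big xpredT xpredT).
Qed.

(** Weight of the atom (j, t); the ordinal is 0-based, whence the successor. *)
Let a (i : 'I_N * tvec n) : R := N%:R^-1 * P i.1.+1 i.2.

Let idxN (i : 'I_N * tvec n) : (1 <= i.1.+1 <= N)%N.
Proof. exact: ltn_ord. Qed.

Let a_ge0 i : 0 <= a i.
Proof.
have [[P0 _] _] := Pp (idxN i).
by rewrite mulr_ge0 ?invr_ge0 ?ler0n.
Qed.

Let a_inT i : ~~ inT n i.2 -> a i = 0.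
Proof.
have [[_ [PT _]] _] := Pp (idxN i).
by move=> h; rewrite /a PT ?mulr0.
Qed.

Let N_neq0 : N%:R != 0 :> R.
Proof. by rewrite pnatr_eq0; lia. Qed.

Let sum_a (g : nat -> R) : \sum_i a i * g i.1.+1 = N%:R^-1 * \sum_(1 <= j < N.+1) g j.
Proof.
rewrite (sum_pair_nat (fun j t => N%:R^-1 * P j t * g j)) mulr_sumr.
apply: eq_big_nat => j hj; have [[_ [_ P1]] _] := Pp hj.
by rewrite -mulr_suml -mulr_sumr P1 mulr1.
Qed.

Let a1 : \sum_i a i = 1.
Proof.
have := sum_a (fun=> 1); under eq_bigr do rewrite mulr1.
by move=> ->; rewrite big_const_nat subSS subn0 iter_addr addr0 mulVf.
Qed.

(** Cost of moving each atom back to its own sample. After averaging over t, the triangle inequality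
    bounds Psum |u - uh| = |q (uL - uh) + r (uU - uh)| by the matching term of the budget
    constraint. *)
Let lp_cost : \sum_i a i * l1dist R n (uj i.1.+1 i.2) (uh i.1.+1) <= eps.
Proof.
have [cost _] := pqr; apply: le_trans cost.
rewrite (eq_bigr (fun i : 'I_N * tvec n => N%:R^-1 * (P i.1.+1 i.2 *
    \sum_(1 <= k < n.+1) \sum_(k <= l < n.+2)
      cov R i.2 k l * `|ui k l i.1.+1 - crd (uh i.1.+1) k|))); last first.
  move=> i _; have [tT|nT] := boolP (inT n i.2).
    by rewrite l1dist_u_j // /a mulrA.
  by rewrite mulrA -/(a i) a_inT // !mul0r.
rewrite (sum_pair_nat (fun j t => N%:R^-1 * (P j t *
    \sum_(1 <= k < n.+1) \sum_(k <= l < n.+2)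
      cov R t k l * `|ui k l j - crd (uh j) k|))).
under eq_bigr do rewrite -mulr_sumr.
rewrite -mulr_sumr ler_wpM2l ?invr_ge0 ?ler0n //.
apply: ler_sum_nat => j hj.
rewrite (sum_P_cov_mul (fun k l => `|ui k l j - crd (uh j) k|)) //.
apply: ler_sum_nat => k hk; apply: ler_sum_nat => l hl.
have hl' : (k <= l <= n.+1)%N by lia.
have [q0 r0 qr] := lp_pos hj hk hl'; have /andP [hL hU] := uh_bounds hj hk.
rewrite -[X in X * _]ger0_norm; last by lra.
by rewrite -normrM Psum_u_ilj // ler_norml; apply/andP; split; nra.
Qed.

(** The integral is only bounded from below, since the vertex t that indexes an atom need not be
    optimal there; for an optimal p, q, r the reverse bound comes from DRO <= LP. *)
Lemma worst_case_distribution : exists Qs : probability (n.-tuple R) R,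
  [/\ forall A, measurable A -> Qs A = Qstar R n N uL uU uh p q r P A,
      inD1 R n N uL uU uh eps Qs &
      ((lp_obj R n N c d C uL uU uh sbar p q r)%:E <=
        \int[Qs]_u fval R n c d C sbar u)%E].
Proof.
have [Qs [QsE Qsint]] := finite_mixture (a := a) (fun i => uj i.1.+1 i.2) a_ge0 a1.
(* Couples each atom with the sample it was moved from. *)
have [Pi [PiE Piint]] :=
  finite_mixture (a := a) (fun i => (uj i.1.+1 i.2, uh i.1.+1)) a_ge0 a1.
exists Qs; split.
- move=> A _; rewrite QsE /Qstar.
  rewrite (eq_bigr (fun i : 'I_N * tvec n => (N%:R^-1 * (P i.1.+1 i.2 *
     (uj i.1.+1 i.2 \in A)%:R))%:E)); last first.
    by move=> i _; rewrite diracE -EFinM /a mulrA.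
  rewrite sumEFin (sum_pair_nat (fun j t => N%:R^-1 * (P j t * (uj j t \in A)%:R))).
  rewrite (eq_big_nat _ _ (F2 := fun j =>
      (\sum_t P j t * (uj j t \in A)%:R)%:E)); last first.
    move=> j hj; have [[_ [PT _]] _] := Pp hj.
    rewrite big_mkcond -sumEFin; apply: eq_bigr => t _.
    by case: ifPn => [_|/PT ->]; rewrite ?mul0r // diracE EFinM.
  rewrite sumEFin -EFinM mulr_sumr; congr EFin; apply: eq_bigr => j _.
  by rewrite mulr_sumr.
- split.
    rewrite QsE (eq_bigr (fun i => (a i)%:E)) ?sumEFin ?a1 // => i _.
    have [tT|nT] := boolP (inT n i.2); last by rewrite a_inT // mul0e.
    by rewrite diracE mem_set ?mule1 //; exact: u_j_box.
  apply: ge_ereal_inf; exists (\int[Pi]_x (l1dist R n x.1 x.2)%:E)%E.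
    exists Pi => // A mA; rewrite !PiE QsE; split.
      by apply: eq_bigr => i _; rewrite !diracE in_setX in_setT andbT.
    rewrite /empirical (eq_bigr (fun i : 'I_N * tvec n =>
      (a i * (uh i.1.+1 \in A)%:R)%:E)); last first.
      by move=> i _; rewrite diracE in_setX in_setT /= EFinM.
    rewrite sumEFin (sum_a (fun j => (uh j \in A)%:R)) EFinM -sumEFin.
    by congr (_ * _)%E; apply: eq_bigr => j _; rewrite diracE.
  rewrite Piint /=.
  - by under eq_bigr do rewrite -EFinM; rewrite sumEFin lee_fin.
  - by apply/measurable_EFinP; exact: measurable_l1dist.
  - by move=> y; rewrite lee_fin l1dist_ge0.
have fE := fvalEfr sbar c_ge0 d_ge0 C_ge0 dc.
rewrite Qsint; last 2 first.
- rewrite (_ : fval R n c d C sbar = EFin \o fr c d C sbar); last first.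
    by apply/funext => u; rewrite fE.
  apply/measurable_EFinP; apply: (measurable_fr sbar c_ge0 d_ge0 C_ge0 dc (Y := id)).
  exact: measurable_crd.
- by move=> u; rewrite fE lee_fin fr_ge0.
under eq_bigr do rewrite fE -EFinM.
rewrite sumEFin lee_fin.
apply: (@le_trans _ _ (\sum_i a i * vertex_value c d C sbar i.2
   (crd (uj i.1.+1 i.2)))); last first.
  apply: ler_sum => i _; have [tT|nT] := boolP (inT n i.2); last first.
    by rewrite a_inT // !mul0r.
  by rewrite ler_wpM2l ?a_ge0 // vertex_le_fr.
rewrite (eq_bigr (fun i : 'I_N * tvec n => N%:R^-1 * (P i.1.+1 i.2 *
    \sum_(1 <= k < n.+1) \sum_(k <= l < n.+2)
      cov R i.2 k l * (piC R n c d C k l * (ui k l i.1.+1 - sbar k))))); last first.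
  move=> i _; have [tT|nT] := boolP (inT n i.2).
    by rewrite vertex_value_u_j // /a mulrA.
  by rewrite mulrA -/(a i) a_inT // !mul0r.
rewrite (sum_pair_nat (fun j t => N%:R^-1 * (P j t *
    \sum_(1 <= k < n.+1) \sum_(k <= l < n.+2)
      cov R t k l * (piC R n c d C k l * (ui k l j - sbar k))))).
under eq_bigr do rewrite -mulr_sumr.
rewrite -mulr_sumr le_eqVlt; apply/orP; left; apply/eqP; congr (_ * _).
apply: eq_big_nat => j hj.
rewrite (sum_P_cov_mul (fun k l => piC R n c d C k l * (ui k l j - sbar k))) //.
apply: eq_big_nat => k hk; apply: eq_big_nat => l hl.
have hl' : (k <= l <= n.+1)%N by lia.
have uE := Psum_u_ilj hj hk hl'.
rewrite [RHS]mulrCA; congr (_ * _).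
have -> : Ps k l j * (ui k l j - sbar k) =
  Ps k l j * (ui k l j - crd (uh j) k) + Ps k l j * (crd (uh j) k - sbar k) by ring.
by rewrite uE; ring.
Qed.

End WorstCase.

(** * Projection onto the box *)

Section Clip.
Variables (R : realType) (n : nat) (uL uU : nat -> R).
Local Notation crd := (crd R n).

(** Replacing u by its projection makes the coordinates bounded everywhere rather than almost
    surely; integrals under [Q] do not change, since [Q] is carried by the box. *)
Definition clip (u : n.-tuple R) : n.-tuple R :=
  [tuple Num.max (uL i.+1) (Num.min (uU i.+1) (tnth u i)) | i < n].

Lemma crd_clip u i : (1 <= i <= n)%N ->
  crd (clip u) i = Num.max (uL i) (Num.min (uU i) (crd u i)).
Proof.
case: i => // i hi.
by rewrite !(@crd_tnth _ _ _ (Ordinal hi)) tnth_mktuple.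
Qed.

Lemma clip_bounds u i : (1 <= i <= n)%N -> uL i <= uU i ->
  uL i <= crd (clip u) i <= uU i.
Proof.
move=> hi LU; rewrite crd_clip // le_max lexx /= ge_max LU /=.
by rewrite ge_min lexx.
Qed.

Lemma clip_id u : Ubox R n uL uU u -> clip u = u.
Proof.
move=> uB; apply: eq_crd => i hi; rewrite crd_clip //.
by have /andP [hL hU] := uB i hi; rewrite min_r // max_r.
Qed.

Lemma clip_dist u i a : (1 <= i <= n)%N -> uL i <= a <= uU i ->
  `|crd (clip u) i - a| <= `|crd u i - a|.
Proof.
move=> hi /andP [hL hU]; rewrite crd_clip //.
have LU : uL i <= uU i by lra.
case: (leP (uU i) (crd u i)) => h1; first by rewrite max_r // !ger0_norm; lra.
case: (leP (uL i) (crd u i)) => h2 //.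
by rewrite !ler0_norm; lra.
Qed.

Lemma measurable_crd_clip i : measurable_fun setT (fun u => crd (clip u) i).
Proof.
have [ni|ni] := ltnP i.-1 n; last first.
  rewrite (_ : (fun _ => _) = fun=> 0) //; apply/funext => u.
  by rewrite /Defs.crd nth_default // size_tuple.
rewrite (_ : (fun _ => _) = (fun u =>
  Num.max (uL i.-1.+1) (Num.min (uU i.-1.+1) (crd u i.-1.+1)))).
  apply: measurable_maxr => //; apply: measurable_minr => //.
  exact: measurable_crd.
by apply/funext => u; rewrite -crd_clip //; exact: ni.
Qed.

End Clip.

Lemma measurable_eq_snd (R : realType) (n : nat) (a : n.-tuple R) :
  measurable_fun setT (fun x : n.-tuple R * n.-tuple R => x.2 == a).
Proof.
move=> mD; apply: (measurable_fun_bool true) => //; rewrite setTI.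
rewrite (_ : _ @^-1` _ = setT `*` [set a]).
  by apply: measurableX => //; exact: measurable_tuple1.
by apply/seteqP; split => x /=; [move=> /eqP|move=> [_ ->]; rewrite eqxx].
Qed.

(** * From a coupling to a feasible point of the linear program *)

Section UpperBound.
Variables (R : realType) (n N : nat) (c d : nat -> R) (C : R).
Variables (uL uU : nat -> R) (uh : nat -> n.-tuple R) (sbar : nat -> R).
Hypothesis N_gt0 : (1 <= N)%N.
Hypothesis c_ge0 : forall i, (1 <= i <= n)%N -> 0 <= c i.
Hypothesis d_ge0 : forall i, (1 <= i <= n)%N -> 0 <= d i.
Hypothesis C_ge0 : 0 <= C.
Hypothesis dc : forall i, (1 <= i <= n.-1)%N -> d i.+1 - d i <= c i.+1.
Hypothesis uLU : forall i, (1 <= i <= n)%N -> uL i < uU i.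
Hypothesis uh_box : forall j, (1 <= j <= N)%N -> Ubox R n uL uU (uh j).
Local Notation X := (n.-tuple R).
Local Notation XX := (X * X)%type.
Variables (Q : probability X R) (Pi : probability XX R) (kappa : R).
Hypothesis Pi_coupling : is_coupling R n Pi Q (empirical R n N uh).
Hypothesis Q_box : Q (Ubox R n uL uU) = 1%E.
Hypothesis Pi_cost : (\int[Pi]_x (l1dist R n x.1 x.2)%:E <= kappa%:E)%E.
Local Notation E h := (Rintegral Pi setT h).
Local Notation crd := (crd R n).
Local Notation pi := (piC R n c d C).

Let N_neq0 : N%:R != 0 :> R.
Proof. by rewrite pnatr_eq0; lia. Qed.

Let Y (x : XX) : X := clip uL uU x.1.
Let mY i : measurable_fun setT (fun x => crd (Y x) i).
Proof. exact: (measurableT_comp (measurable_crd_clip uL uU i)). Qed.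

Let y (i : nat) (x : XX) : R := crd (Y x) i.
Let y_bounds i x : (1 <= i <= n)%N -> uL i <= y i x <= uU i.
Proof. by move=> hi; apply: clip_bounds => //; apply: ltW; exact: uLU. Qed.

Let y_bmeas i : (1 <= i <= n)%N -> bmeas (y i).
Proof.
move=> hi; split; first exact: mY.
exists (`|uL i| + `|uU i|) => x; have /andP [h1 h2] := y_bounds x hi.
rewrite ler_norml; apply/andP; split.
  have := ler_norm (- uL i); rewrite normrN => h3.
  by have := normr_ge0 (uU i) => h4; lra.
by have := ler_norm (uU i) => h3; have := normr_ge0 (uL i) => h4; lra.
Qed.

Let tau (x : XX) := best_vertex (vertex_table c d C sbar (Y x)).
Let tauT x : inT n (tau x).
Proof. by have [] := best_vertexP sbar c_ge0 d_ge0 C_ge0 dc (Y x). Qed.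

Let cv (i l : nat) (x : XX) : R := cov R (tau x) i l.
Let cv_ge0 i l x : 0 <= cv i l x. Proof. exact: cov_ge0. Qed.
Let cv_bmeas i l : bmeas (cv i l).
Proof. exact: (bmeas_best c d C sbar mY (fun t => cov R t i l)). Qed.

Let sum_cv i x : (1 <= i <= n)%N -> \sum_(i <= l < n.+2) cv i l x = 1.
Proof. by move=> hi; apply: sum_cov => //; lia. Qed.

Let mult (j : nat) : R := \sum_(1 <= j' < N.+1) (uh j' == uh j)%:R.
Let mult_gt0 j : (1 <= j <= N)%N -> 0 < mult j.
Proof.
move=> hj; rewrite /mult (bigD1_seq j) ?iota_uniq ?mem_index_iota //= eqxx.
by rewrite ltr_wpDr // sumr_ge0.
Qed.

(* Splits the event x.2 = uh j evenly among the indices with the same sample. *)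
Let B (j : nat) (x : XX) : R := (mult j)^-1 * (x.2 == uh j)%:R.
Let B_ge0 j x : (1 <= j <= N)%N -> 0 <= B j x.
Proof. by move=> hj; rewrite mulr_ge0 // invr_ge0 ltW // mult_gt0. Qed.
Let B_bmeas j : bmeas (B j).
Proof. by apply: bmeasZ; apply: bmeas_bool; exact: measurable_eq_snd. Qed.

Let E_B j : (1 <= j <= N)%N -> E (B j) = N%:R^-1.
Proof.
move=> hj; rewrite bexpZ; last by apply: bmeas_bool; exact: measurable_eq_snd.
suff -> : E (fun x : XX => (x.2 == uh j)%:R) = N%:R^-1 * mult j.
  by rewrite mulrCA mulVf ?mulr1 // gt_eqF ?mult_gt0.
rewrite /Rintegral.
have mA : measurable (setT `*` [set uh j] : set XX).
  by apply: measurableX => //; exact: measurable_tuple1.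
have -> : (\int[Pi]_x ((x.2 == uh j)%:R)%:E =
    \int[Pi]_x (\1_(setT `*` [set uh j]) x)%:E)%E.
  apply: eq_integral => x _; rewrite indicE in_setX in_setT /=.
  by congr ((_ : bool)%:R%:E); apply/eqP/idP => [->|]; rewrite inE.
rewrite integral_indic // setIT.
have [_ PiE] := Pi_coupling (measurable_tuple1 (uh j)).
transitivity (fine (empirical R n N uh [set uh j])); first by congr fine.
rewrite /empirical (eq_bigr (fun j' => ((uh j' == uh j)%:R)%:E)); last first.
  move=> j' _; rewrite diracE; congr ((_ : bool)%:R%:E).
  by apply/idP/eqP => [|->]; rewrite inE.
by rewrite sumEFin -EFinM.
Qed.

Let sum_B_le1 x : \sum_(1 <= j < N.+1) B j x <= 1.
Proof.
have [/hasP [j0]|] := boolP (has (fun j => x.2 == uh j) (index_iota 1 N.+1)).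
  rewrite mem_index_iota => hj0 /eqP xj.
  rewrite (eq_bigr (fun j => (mult j0)^-1 * (uh j == uh j0)%:R)).
    by rewrite -mulr_sumr -/(mult j0) mulVf // gt_eqF ?mult_gt0.
  move=> j _; rewrite /B xj eq_sym; case: eqP => [e|_]; last by rewrite !mulr0.
  by rewrite /mult e.
move=> /hasPn no; rewrite big_seq big1 ?ler01 // => j /no /negbTE.
by rewrite /B => ->; rewrite mulr0.
Qed.

(** Since [B j] has expectation 1/N, this is the expectation of h under the density N [B j], that
    is, given the index j. *)
Let V (j : nat) (h : XX -> R) : R := N%:R * E (fun x => B j x * h x).

Let V_sum j (I : eqType) (s : seq I) (F : I -> XX -> R) :
  (forall i, i \in s -> bmeas (F i)) ->
  V j (fun x => \sum_(i <- s) F i x) = \sum_(i <- s) V j (F i).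
Proof.
move=> bF; rewrite /V; under eq_fun do rewrite mulr_sumr.
rewrite bexp_sum ?mulr_sumr // => i si.
by apply: bmeasM => //; exact: bF.
Qed.

Let V_Z j r h : bmeas h -> V j (fun x => r * h x) = r * V j h.
Proof.
move=> bh; rewrite /V; under eq_fun do rewrite mulrCA.
by rewrite bexpZ ?(mulrCA r) //; exact: bmeasM.
Qed.

Let V_D j g h : bmeas g -> bmeas h -> V j (fun x => g x + h x) = V j g + V j h.
Proof.
move=> bg bh; rewrite /V; under eq_fun do rewrite mulrDr.
by rewrite bexpD ?mulrDr //; exact: bmeasM.
Qed.

Let V_ge0 j h : (1 <= j <= N)%N -> (forall x, 0 <= h x) -> 0 <= V j h.
Proof.
by move=> hj h0; rewrite mulr_ge0 // bexp_ge0 // => x; rewrite mulr_ge0 ?B_ge0.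
Qed.

Let V_1 j : (1 <= j <= N)%N -> V j (fun=> 1) = 1.
Proof.
by move=> hj; rewrite /V; under eq_fun do rewrite mulr1; rewrite E_B ?divff.
Qed.

Let avg_V (h : nat -> XX -> R) : (forall j, (1 <= j <= N)%N -> bmeas (h j)) ->
  N%:R^-1 * \sum_(1 <= j < N.+1) V j (h j) =
  E (fun x => \sum_(1 <= j < N.+1) B j x * h j x).
Proof.
move=> bh; rewrite bexp_sum; last first.
  by move=> j; rewrite mem_index_iota => hj; apply: bmeasM => //; exact: bh.
rewrite mulr_sumr; apply: eq_bigr => j _.
by rewrite /V mulrA mulVf ?mul1r.
Qed.

(** Fraction of the way from the sample to uL covered by y. If the sample has i-th coordinate uL,
    the inverse is 0 by convention, and the numerator is 0 too because y >= uL. [be] is the same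
    towards uU. *)
Let al (i j : nat) (x : XX) : R :=
  (crd (uh j) i - uL i)^-1 * Num.max 0 (crd (uh j) i - y i x).
Let be (i j : nat) (x : XX) : R :=
  (uU i - crd (uh j) i)^-1 * Num.max 0 (y i x - crd (uh j) i).

Let al_bmeas i j : (1 <= i <= n)%N -> bmeas (al i j).
Proof.
move=> hi; apply: bmeasZ; apply: bmeas_max; first exact: bmeas_cst.
by apply: bmeasB; [exact: bmeas_cst|exact: y_bmeas].
Qed.

Let be_bmeas i j : (1 <= i <= n)%N -> bmeas (be i j).
Proof.
move=> hi; apply: bmeasZ; apply: bmeas_max; first exact: bmeas_cst.
by apply: bmeasB; [exact: y_bmeas|exact: bmeas_cst].
Qed.

Let al_be i j x : (1 <= i <= n)%N -> (1 <= j <= N)%N ->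
  [/\ 0 <= al i j x, 0 <= be i j x, al i j x + be i j x <= 1,
      (crd (uh j) i - uL i) * al i j x = Num.max 0 (crd (uh j) i - y i x) &
      (uU i - crd (uh j) i) * be i j x = Num.max 0 (y i x - crd (uh j) i)].
Proof.
move=> hi hj; have /andP [hL hU] := uh_box hj hi.
have /andP [yL yU] := y_bounds x hi.
have frac0 D (z : R) : 0 <= z -> z <= D ->
    [/\ 0 <= D^-1 * z, D^-1 * z <= 1 & D * (D^-1 * z) = z].
  move=> z0 zD; have [D0|D0] := eqVneq D 0.
    by have -> : z = 0 by [lra]; rewrite !mulr0.
  have D1 : 0 < D by rewrite lt_def D0; lra.
  split; last by rewrite mulVKf.
    by rewrite mulr_ge0 // invr_ge0 ltW.
  by rewrite ler_pdivrMl // mulr1.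
have [yu|uy] := leP (y i x) (crd (uh j) i).
  have be0 : Num.max 0 (y i x - crd (uh j) i) = 0 by rewrite max_l; lra.
  have alE : Num.max 0 (crd (uh j) i - y i x) = crd (uh j) i - y i x.
    by rewrite max_r; lra.
  rewrite /al /be be0 alE !mulr0 addr0.
  by have [] := frac0 (crd (uh j) i - uL i) (crd (uh j) i - y i x); [lra|lra|].
have al0 : Num.max 0 (crd (uh j) i - y i x) = 0 by rewrite max_l; lra.
have beE : Num.max 0 (y i x - crd (uh j) i) = y i x - crd (uh j) i.
  by rewrite max_r; lra.
rewrite /al /be al0 beE !mulr0 add0r.
by have [] := frac0 (uU i - crd (uh j) i) (y i x - crd (uh j) i); [lra|lra|].
Qed.

Let p (k l j : nat) : R := V j (fun x => (tv n (tau x) k l : nat)%:R).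
Let q (i l j : nat) : R := V j (fun x => cv i l x * al i j x).
Let r (i l j : nat) : R := V j (fun x => cv i l x * be i j x).

Let Psum_p i l j : Psum R p i l j = V j (cv i l).
Proof.
rewrite /Psum /p -V_sum //= => k _.
exact: (bmeas_best c d C sbar mY (fun t => (tv n t k l : nat)%:R)).
Qed.

(** A single linearity statement with free coefficients, used for the cost, for the constraint q + r
    <= Psum and for the objective. *)
Let V_cv_al_be i l j b1 b2 b3 : (1 <= i <= n)%N ->
  b1 * q i l j + b2 * r i l j + b3 * Psum R p i l j =
  V j (fun x => cv i l x * (b1 * al i j x + b2 * be i j x + b3)).
Proof.
move=> hi; have ba : bmeas (fun x => cv i l x * al i j x).
  by apply: bmeasM => //; exact: al_bmeas.
have bb : bmeas (fun x => cv i l x * be i j x).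
  by apply: bmeasM => //; exact: be_bmeas.
rewrite Psum_p /q /r -!V_Z // -!V_D; try by do ?apply: bmeasD; exact: bmeasZ.
by congr (V j _); apply/funext => x; ring.
Qed.

Let V_sum2 j (h : nat -> nat -> XX -> R) :
  (forall i l, (1 <= i <= n)%N -> bmeas (h i l)) ->
  \sum_(1 <= i < n.+1) \sum_(i <= l < n.+2) V j (h i l) =
  V j (fun x => \sum_(1 <= i < n.+1) \sum_(i <= l < n.+2) h i l x).
Proof.
move=> bh; rewrite V_sum; last first.
  by move=> i; rewrite mem_index_iota => hi; apply: bmeas_sum => l _; exact: bh.
by apply: eq_big_nat => i hi; rewrite V_sum // => l _; exact: bh.
Qed.

(** For given j, q and r recombine into the expected l1 distance from [Y] to [uh j]. Since [B j]
    vanishes unless x.2 = [uh j], and clipping does not increase the distance to points of the box,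
    the average over j is at most the cost of [Pi]. *)
Let cost_le : N%:R^-1 * \sum_(1 <= j < N.+1) \sum_(1 <= i < n.+1)
    \sum_(i <= l < n.+2) ((crd (uh j) i - uL i) * q i l j +
                          (uU i - crd (uh j) i) * r i l j) <= kappa.
Proof.
pose dst i j x := `|y i x - crd (uh j) i|.
have dst_bmeas i j : (1 <= i <= n)%N -> bmeas (dst i j).
  move=> hi; have [my [K yK]] := y_bmeas hi; split.
    by apply: measurableT_comp => //; exact: measurable_funB.
  exists (K + `|crd (uh j) i|) => x; rewrite normr_id.
  by apply: le_trans (ler_normB _ _) _; rewrite lerD2r.
rewrite (eq_big_nat _ _ (F2 := fun j =>
   V j (fun x => \sum_(1 <= i < n.+1) dst i j x))); last first.
  move=> j hj.
  transitivity (V j (fun x => \sum_(1 <= i < n.+1) \sum_(i <= l < n.+2)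
                                 cv i l x * dst i j x)).
    rewrite -V_sum2; last first.
      by move=> i l hi; apply: bmeasM => //; exact: dst_bmeas.
    apply: eq_big_nat => i hi; apply: eq_big_nat => l hl.
    have := V_cv_al_be l j (crd (uh j) i - uL i) (uU i - crd (uh j) i) 0 hi.
    rewrite mul0r addr0 => ->; congr (V j _); apply/funext => x; congr (_ * _).
    have [_ _ _ -> ->] := al_be x hi hj; rewrite addr0 /dst.
    have [h|h] := leP (y i x) (crd (uh j) i).
      by rewrite max_r ?max_l ?ler0_norm; lra.
    by rewrite max_l ?max_r ?ger0_norm; lra.
  congr (V j _); apply/funext => x; apply: eq_big_nat => i hi.
  by rewrite -mulr_suml sum_cv // mul1r.
rewrite avg_V; last first.
  move=> j hj; apply: bmeas_sum => i; rewrite mem_index_iota => hi.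
  exact: dst_bmeas.
rewrite -lee_fin; apply: le_trans Pi_cost.
have bsum : bmeas (fun x => \sum_(1 <= j < N.+1) B j x *
    \sum_(1 <= i < n.+1) dst i j x).
  apply: bmeas_sum => j _; apply: bmeasM => //; apply: bmeas_sum => i.
  by rewrite mem_index_iota => hi; exact: dst_bmeas.
rewrite bexpE //; apply: ge0_le_integral => //.
- move=> x _; rewrite lee_fin big_nat_cond sumr_ge0 // => j /andP [hj _].
  apply: mulr_ge0; first exact: B_ge0.
  by apply: sumr_ge0 => i _; exact: normr_ge0.
- by apply/measurable_EFinP; case: bsum.
- by apply/measurable_EFinP; exact: measurable_l1dist.
move=> x _; rewrite lee_fin.
apply: (@le_trans _ _ (\sum_(1 <= j < N.+1) B j x * l1dist R n x.1 x.2)).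
  apply: ler_sum_nat => j hj; rewrite /B.
  case: eqP => [->|_]; last by rewrite mulr0 !mul0r.
  rewrite ler_wpM2l //; first by rewrite mulr1 invr_ge0 ltW // mult_gt0.
  apply: ler_sum_nat => i hi; apply: clip_dist => //.
  exact: uh_box.
by rewrite -mulr_suml ler_piMl ?l1dist_ge0.
Qed.

Let lp_feasible : lp_feas R n N uL uU uh kappa p q r.
Proof.
split; first exact: cost_le.
split.
  move=> i j hi hj; under eq_bigr do rewrite Psum_p.
  rewrite -V_sum // -[RHS](V_1 hj); congr (V j _); apply/funext => x.
  exact: sum_cv.
split.
  move=> i l j hi hl hj.
  have := V_cv_al_be l j (-1) (-1) 1 hi; rewrite !mulN1r mul1r => E0.
  rewrite (_ : _ - _ - _ = - q i l j - r i l j + Psum R p i l j); last by ring.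
  rewrite E0; apply: V_ge0 => // x; rewrite mulr_ge0 //.
  by have [a0 b0 ab1 _ _] := al_be x hi hj; lra.
move=> i l j hi hl hj; split; first exact: V_ge0.
by split; apply: V_ge0 => // x; rewrite mulr_ge0 //;
  have [] := al_be x hi hj.
Qed.

Let F (x : XX) : R := fr c d C sbar (Y x).

Let FE x : F x = \sum_(1 <= i < n.+1) \sum_(i <= l < n.+2)
  cv i l x * (pi i l * (y i x - sbar i)).
Proof. by rewrite /F; have [_ ->] := best_vertexP sbar c_ge0 d_ge0 C_ge0 dc (Y x). Qed.

Let term_bmeas i l : (1 <= i <= n)%N ->
  bmeas (fun x => cv i l x * (pi i l * (y i x - sbar i))).
Proof.
move=> hi; apply: bmeasM => //; apply: bmeasZ; apply: bmeasB; last exact: bmeas_cst.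
exact: y_bmeas.
Qed.

Let F_bmeas : bmeas F.
Proof.
have -> : F = (fun x => \sum_(1 <= i < n.+1) \sum_(i <= l < n.+2)
    cv i l x * (pi i l * (y i x - sbar i))) by apply/funext => x; exact: FE.
apply: bmeas_sum => i; rewrite mem_index_iota => hi; apply: bmeas_sum => l _.
exact: term_bmeas.
Qed.

(** The displacements [al] and [be] lead from the sample back to y, so the summand for j is [V j F].
    Averaging over j gives the expectation of S F, with S the sum of all [B j]. *)
Let lp_obj_E : lp_obj R n N c d C uL uU uh sbar p q r = E F.
Proof.
rewrite /lp_obj (eq_big_nat _ _ (F2 := fun j => V j F)); last first.
  move=> j hj.
  transitivity (V j (fun x => \sum_(1 <= i < n.+1) \sum_(i <= l < n.+2)
     cv i l x * (pi i l * (y i x - sbar i)))); last first.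
    by congr (V j _); apply/funext => x; rewrite FE.
  rewrite -V_sum2; last by move=> i l; exact: term_bmeas.
  apply: eq_big_nat => i hi; apply: eq_big_nat => l hl.
  rewrite [Psum R p i l j * _]mulrC V_cv_al_be // -V_Z; last first.
    apply: bmeasM => //; apply: bmeasD; last exact: bmeas_cst.
    by apply: bmeasD; apply: bmeasZ; [exact: al_bmeas|exact: be_bmeas].
  congr (V j _); apply/funext => x; rewrite [LHS]mulrCA; congr (_ * (_ * _)).
  have [_ _ _ alE beE] := al_be x hi hj.
  have -> : (uL i - crd (uh j) i) * al i j x = - ((crd (uh j) i - uL i) * al i j x).
    by ring.
  rewrite alE beE; have [h|h] := leP (y i x) (crd (uh j) i).
    by rewrite max_r ?max_l; lra.
  by rewrite max_l ?max_r; lra.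
rewrite avg_V //.
pose S x := \sum_(1 <= j < N.+1) B j x.
have S_bmeas : bmeas S by apply: bmeas_sum.
have E_S : E S = 1.
  rewrite bexp_sum // (eq_big_nat _ _ (F2 := fun=> N%:R^-1)) //.
  by rewrite big_const_nat subSS subn0 iter_addr addr0 -[LHS]mulr_natr mulVf.
have -> : (fun x => \sum_(1 <= j < N.+1) B j x * F x) = (fun x => S x * F x).
  by apply/funext => x; rewrite mulr_suml.
have [K FK] := F_bmeas.2.
have bSF : bmeas (fun x => S x * F x) by exact: bmeasM.
have F0 x : 0 <= F x by exact: fr_ge0.
(* S <= 1 and E S = 1 make S equal to 1 almost surely. In place of an almost-everywhere argument, (1
   - S)(K - F) >= 0 is integrated. *)
have loss : E (fun x => K * S x + F x) <= E (fun x => K + S x * F x).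
  apply: bexp_le.
  - by apply: bmeasD => //; exact: bmeasZ.
  - by apply: bmeasD => //; exact: bmeas_cst.
  move=> x; have S1 : S x <= 1 by exact: sum_B_le1.
  have FKx : F x <= K by apply: le_trans (ler_norm _) (FK x).
  by have : 0 <= (1 - S x) * (K - F x) by [rewrite mulr_ge0; lra]; lra.
rewrite !bexpD ?bexpZ ?bexp_cst ?E_S // in loss; last 2 first.
- exact: bmeas_cst.
- exact: bmeasZ.
have SF : E (fun x => S x * F x) <= E F.
  apply: bexp_le => // x; apply: ler_piMl; first exact: F0.
  exact: sum_B_le1.
by apply/eqP; rewrite eq_le SF /=; lra.
Qed.

(** [Q] is carried by the box, where clipping is the identity, and the first marginal of [Pi] is
    [Q]. *)
Let integral_Q : (\int[Q]_u fval R n c d C sbar u = (E F)%:E)%E.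
Proof.
have fE := fvalEfr sbar c_ge0 d_ge0 C_ge0 dc.
have mfr := measurable_fr sbar c_ge0 d_ge0 C_ge0 dc (Y := id) measurable_crd.
have mfc := measurable_fr sbar c_ge0 d_ge0 C_ge0 dc (measurable_crd_clip uL uU).
have fr0 := fr_ge0 sbar c_ge0 d_ge0 C_ge0 dc.
transitivity (\int[Q]_u (fr c d C sbar (clip uL uU u))%:E)%E.
  rewrite (eq_integral (fun u => (fr c d C sbar u)%:E)); last by move=> u _; exact: fE.
  apply: ge0_ae_eq_integral => //.
  - exact/measurable_EFinP.
  - exact/measurable_EFinP.
  - by move=> u _; rewrite lee_fin.
  - by move=> u _; rewrite lee_fin.
  exists (~` Ubox R n uL uU); split.
  - by apply: measurableC; exact: measurable_box.
  - by have := probability_setC Q (@measurable_box R n uL uU); rewrite Q_box subee.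
  move=> u /= h uB; apply: h => _; by rewrite clip_id.
rewrite bexpE // (eq_measure_integral (pushforward Pi fst)); last first.
  move=> A mA _; have [PiA _] := Pi_coupling mA.
  apply: etrans (esym PiA) _; congr (Pi _).
  by apply/seteqP; split => x /=; [case|].
rewrite ge0_integral_pushforward //.
- exact/measurable_EFinP.
- by move=> u _; rewrite lee_fin.
Qed.

Lemma coupling_lp : exists p q r, lp_feas R n N uL uU uh kappa p q r /\
  (\int[Q]_u fval R n c d C sbar u =
   (lp_obj R n N c d C uL uU uh sbar p q r)%:E)%E.
Proof. by exists p, q, r; rewrite lp_obj_E integral_Q. Qed.

End UpperBound.

(* Shrinking q and r by eps / (eps + dl) restores the budget eps, also when
   eps = 0, at a loss linear in dl. *)
Lemma lp_shrink (R : realType) (n N : nat) (c d : nat -> R) (C : R)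
    (uL uU : nat -> R) (uh : nat -> n.-tuple R) (sbar : nat -> R) (eps dl : R)
    (p q r : nat -> nat -> nat -> R) :
  (forall j, (1 <= j <= N)%N -> Ubox R n uL uU (uh j)) ->
  0 <= eps -> 0 < dl -> lp_feas R n N uL uU uh (eps + dl) p q r ->
  let th := eps / (eps + dl) in
  let q' := fun i l j => th * q i l j in
  let r' := fun i l j => th * r i l j in
  lp_feas R n N uL uU uh eps p q' r' /\
  lp_obj R n N c d C uL uU uh sbar p q r <=
  lp_obj R n N c d C uL uU uh sbar p q' r' +
    (\sum_(1 <= i < n.+1) \sum_(i <= l < n.+2) `|piC R n c d C i l|) * dl.
Proof.
move=> uh_box eps_ge0 dl_gt0 [cost [p1 [pqr pqr0]]] th q' r'.
set M := \sum_(_ <= _ < _) _.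
have ed : 0 < eps + dl by lra.
have th_ge0 : 0 <= th by rewrite divr_ge0 // ltW.
have th_le1 : th <= 1 by rewrite ler_pdivrMr // mul1r; lra.
have thE : th * (eps + dl) = eps by rewrite divfK // gt_eqF.
have piM i l : (1 <= i <= n)%N -> (i <= l <= n.+1)%N -> `|piC R n c d C i l| <= M.
  move=> hi hl; rewrite /M (bigD1_seq i) ?iota_uniq ?mem_index_iota //=.
  rewrite (bigD1_seq l) ?iota_uniq ?mem_index_iota //=.
  by rewrite -addrA lerDl addr_ge0 // sumr_ge0 // => *; rewrite sumr_ge0.
split.
  split.
    apply: (@le_trans _ _ (th * (eps + dl))); last by rewrite thE.
    apply: le_trans (ler_wpM2l th_ge0 cost); rewrite mulrCA ler_wpM2l ?invr_ge0 //.
    rewrite mulr_sumr ler_sum // => j _; rewrite mulr_sumr ler_sum // => i _.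
    rewrite mulr_sumr ler_sum // => l _; rewrite /q' /r'.
    by rewrite le_eqVlt; apply/orP; left; apply/eqP; ring.
  split => //; split => i l j hi hl hj.
    have [_ [q0 r0]] := pqr0 i l j hi hl hj.
    have h := pqr i l j hi hl hj.
    have h1 : th * q i l j <= q i l j by rewrite ler_piMl.
    have h2 : th * r i l j <= r i l j by rewrite ler_piMl.
    by rewrite /q' /r'; lra.
  have [p0 [q0 r0]] := pqr0 i l j hi hl hj.
  by split => //; split; exact: mulr_ge0.
(* Every |pi| is at most M, so shrinking loses at most (1 - th) M times the cost of q and r, hence
   at most (1 - th) M (eps + dl) = M dl. *)
have key : lp_obj R n N c d C uL uU uh sbar p q r <=
  lp_obj R n N c d C uL uU uh sbar p q' r' +
  (1 - th) * M * (N%:R^-1 * \sum_(1 <= j < N.+1) \sum_(1 <= i < n.+1)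
    \sum_(i <= l < n.+2) ((crd R n (uh j) i - uL i) * q i l j +
                          (uU i - crd R n (uh j) i) * r i l j)).
  rewrite /lp_obj mulrCA -mulrDr ler_wpM2l ?invr_ge0 //.
  rewrite mulr_sumr -big_split /=; apply: ler_sum_nat => j hj.
  rewrite mulr_sumr -big_split /=; apply: ler_sum_nat => i hi.
  rewrite mulr_sumr -big_split /=; apply: ler_sum_nat => l hl.
  have hl' : (i <= l <= n.+1)%N by lia.
  have [_ [q0 r0]] := pqr0 i l j hi hl' hj.
  have /andP [hL hU] := uh_box j hj i hi.
  have := piM i l hi hl'; rewrite ler_norml => /andP [piL piU].
  rewrite /q' /r'; set b := Psum _ _ _ _ _ * _.
  set x := crd R n (uh j) i in hL hU *.
  have h1 : 0 <= (M + piC R n c d C i l) * ((x - uL i) * q i l j).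
    by rewrite !mulr_ge0 //; lra.
  have h2 : 0 <= (M - piC R n c d C i l) * ((uU i - x) * r i l j).
    by rewrite !mulr_ge0 //; lra.
  have h3 : 0 <= (1 - th) * ((M + piC R n c d C i l) * ((x - uL i) * q i l j)).
    by rewrite mulr_ge0 //; lra.
  have h4 : 0 <= (1 - th) * ((M - piC R n c d C i l) * ((uU i - x) * r i l j)).
    by rewrite mulr_ge0 //; lra.
  by lra.
apply: le_trans key _; rewrite lerD2l.
have M_ge0 : 0 <= M by apply: sumr_ge0 => i _; exact: sumr_ge0.
apply: (@le_trans _ _ ((1 - th) * M * (eps + dl))).
  by rewrite ler_wpM2l // mulr_ge0 // subr_ge0.
have -> : (1 - th) * M * (eps + dl) = M * ((eps + dl) - th * (eps + dl)) by ring.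
by rewrite thE addrC addKr.
Qed.

(** * Equality of the two values and optimality of the constructed distribution *)

Theorem theorem5 (R : realType) (n N : nat) (T : R) (c d : nat -> R) (C : R)
    (uL uU : nat -> R) (uh : nat -> n.-tuple R) (sbar : nat -> R) (eps : R) :
  (1 <= n)%N -> (1 <= N)%N -> 0 < T ->
  (forall i, (1 <= i <= n)%N -> 0 <= c i) ->
  (forall i, (1 <= i <= n)%N -> 0 <= d i) ->
  0 <= C ->
  (forall i, (1 <= i <= n.-1)%N -> d i.+1 - d i <= c i.+1) ->
  (forall i, (1 <= i <= n)%N -> 0 <= uL i /\ uL i < uU i) ->
  (forall j, (1 <= j <= N)%N -> Ubox R n uL uU (uh j)) ->
  in_S R n T sbar ->
  0 <= eps ->
  DRO_value R n N c d C uL uU uh eps sbar = LP_value R n N c d C uL uU uh eps sbar /\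
  (forall ps qs rs : nat -> nat -> nat -> R,
    lp_feas R n N uL uU uh eps ps qs rs ->
    (forall p q r, lp_feas R n N uL uU uh eps p q r ->
       lp_obj R n N c d C uL uU uh sbar p q r
         <= lp_obj R n N c d C uL uU uh sbar ps qs rs) ->
    (exists P : nat -> tvec n -> R,
       forall j, (1 <= j <= N)%N -> distT R n (P j) /\ marginals_ok R n (P j) ps j) /\
    (forall P : nat -> tvec n -> R,
       (forall j, (1 <= j <= N)%N -> distT R n (P j) /\ marginals_ok R n (P j) ps j) ->
       exists Qs : probability (n.-tuple R) R,
         (forall A, measurable A -> Qs A = Qstar R n N uL uU uh ps qs rs P A) /\
         inD1 R n N uL uU uh eps Qs /\
         (\int[Qs]_u fval R n c d C sbar u)%E
           = DRO_value R n N c d C uL uU uh eps sbar)).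
Proof.
move=> n_gt0 N_gt0 _ c_ge0 d_ge0 C_ge0 dc uLU uh_box _ eps_ge0.
have decomp p q r : lp_feas R n N uL uU uh eps p q r ->
    exists P : nat -> tvec n -> R, forall j, (1 <= j <= N)%N ->
      distT R n (P j) /\ marginals_ok R n (P j) p j.
  move=> [_ [p1 [_ p0]]].
  have H j : exists Pj : tvec n -> R, (1 <= j <= N)%N ->
      distT R n Pj /\ marginals_ok R n Pj p j.
    have [hj|] := boolP (1 <= j <= N)%N; last by exists (fun=> 0).
    have [||Pj HPj] := flow_decomposition (p := fun k l => p k l j) n_gt0.
    - by move=> k l hk hl; have [] := p0 k l j hk hl hj.
    - by move=> i hi; exact: p1.
    - by exists Pj.
  by have [P HP] := choice H; exists P.
have worst p q r P (pqr : lp_feas R n N uL uU uh eps p q r)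
    (PP : forall j, (1 <= j <= N)%N -> distT R n (P j) /\ marginals_ok R n (P j) p j) :=
  worst_case_distribution sbar N_gt0 c_ge0 d_ge0 C_ge0 dc uh_box pqr PP.
have DRO_le_LP : (DRO_value R n N c d C uL uU uh eps sbar <=
                  LP_value R n N c d C uL uU uh eps sbar)%E.
  apply/ereal_supP => _ [Q [Qbox Qdist] <-]; apply/lee_addgt0Pr => e e_gt0.
  pose M := \sum_(1 <= i < n.+1) \sum_(i <= l < n.+2) `|piC R n c d C i l|.
  have M_ge0 : 0 <= M by apply: sumr_ge0 => i _; exact: sumr_ge0.
  (* The added 1 keeps the denominator positive when M = 0, and M dl <= e. *)
  pose dl := e / (M + 1).
  have dl_gt0 : 0 < dl by rewrite divr_gt0 //; lra.
  have Mdl : M * dl <= e.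
    by rewrite mulrA ler_pdivrMr; [nra|lra].
  (* The infimum in [d1] is not assumed to be attained, so a coupling of cost at most eps + dl is
     extracted. *)
  have [Pi Pic Picost] : exists2 Pi, is_coupling R n Pi Q (empirical R n N uh) &
      (\int[Pi]_x (l1dist R n x.1 x.2)%:E <= (eps + dl)%:E)%E.
    apply: contrapT => no.
    have : ((eps + dl)%:E <= d1 R n Q (empirical R n N uh))%E.
      apply/ereal_infP => _ [Pi Pic <-]; rewrite leNgt; apply/negP => /ltW lt.
      by apply: no; exists Pi.
    by move=> /le_trans /(_ Qdist); rewrite lee_fin; lra.
  have uLU' i : (1 <= i <= n)%N -> uL i < uU i by move=> /uLU [].
  have [p [q [r [feas ->]]]] := coupling_lp sbar N_gt0 c_ge0 d_ge0 C_ge0 dc uLU'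
    uh_box Pic Qbox Picost.
  have [feas' obj_le] := lp_shrink c d C sbar uh_box eps_ge0 dl_gt0 feas.
  apply: (@le_trans _ _ ((lp_obj R n N c d C uL uU uh sbar p
      (fun i l j => eps / (eps + dl) * q i l j)
      (fun i l j => eps / (eps + dl) * r i l j))%:E + e%:E)%E).
    rewrite -EFinD lee_fin; apply: le_trans obj_le _; rewrite lerD2l.
    exact: Mdl.
  apply: leeD => //; apply: ereal_sup_ubound.
  by do 3!eexists; split; first exact: feas'.
have LP_le_DRO : (LP_value R n N c d C uL uU uh eps sbar <=
                  DRO_value R n N c d C uL uU uh eps sbar)%E.
  apply/ereal_supP => _ [p [q [r [feas ->]]]].
  have [P PP] := decomp p q r feas.
  have [Qs [_ QsD obj_le]] := worst p q r P feas PP.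
  by apply: le_trans obj_le _; apply: ereal_sup_ubound; exists Qs.
split; first by apply/eqP; rewrite eq_le DRO_le_LP LP_le_DRO.
move=> ps qs rs feas opt; split; first exact: decomp feas.
move=> P PP; have [Qs [QsE QsD obj_le]] := worst ps qs rs P feas PP.
exists Qs; split => //; split => //; apply/eqP; rewrite eq_le; apply/andP; split.
  by apply: ereal_sup_ubound; exists Qs.
(* DRO <= LP <= objective at the given optimal solution <= integral under [Qs]. *)
apply: le_trans DRO_le_LP _; apply: le_trans obj_le.
by apply/ereal_supP => _ [p [q [r [feas' ->]]]]; rewrite lee_fin opt.
Qed.
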